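(* Let $m\ge n\ge 2$, let $A\in\mathbb{C}^{m\times m}$ be Hermitian, let $\underline{w}\in\mathbb{C}^{m}$, and let \[ K_{m,n}=\begin{bmatrix}\underline{w} & A\underline{w} & \cdots & A^{n-1}\underline{w}\end{bmatrix}\in\mathbb{C}^{m\times n} \] be the associated Krylov matrix. Then, for every $0<\epsilon<1$ (and $n$ even or odd), \[ \mathrm{rank}_\epsilon(K_{m,n})\le 2\left\lceil\frac{4\log(8\lfloor n/2\rfloor/\pi)\,\log(4/\epsilon)}{\pi^2}\right\rceil+2. \]
   Context: $\sigma_1(X)\ge\cdots\ge\sigma_n(X)\ge 0$ denote the singular values of an $m\times n$ matrix $X$ with $m\ge n$, with the convention $\sigma_{n+1}(X)=0$, and $\|X\|_2=\sigma_1(X)$. For $0<\epsilon<1$, the $\epsilon$-rank is $\mathrm{rank}_\epsilon(X)=\min\{k\ge 0:\sigma_{k+1}(X)\le\epsilon\|X\|_2\}$. *)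

(* Defs.v *)
From HB Require Import structures.
From mathcomp Require Import all_boot all_order all_algebra.
From mathcomp Require Import sesquilinear spectral complex.
From mathcomp Require Import all_classical all_reals all_analysis.

Set Implicit Arguments.
Unset Strict Implicit.
Unset Printing Implicit Defensive.

Import Order.TTheory GRing.Theory Num.Theory.
Local Open Scope ring_scope.
Local Open Scope complex_scope.
Local Open Scope sesquilinear_scope.

(* The square roots of the eigenvalues of X^* X, with multiplicity, in
   nonincreasing order. X^* X is Hermitian positive semidefinite, so
   [spectral_diag] lists its eigenvalues and taking [Re] only transports these
   nonnegative real numbers from R[i] to R. *)
Definition singular_values (R : realType) (m n : nat) (X : 'M[R[i]]_(m, n)) :
    seq R :=
  sort (fun x y => y <= x)
    [seq Num.sqrt (complex.Re (spectral_diag (X ^t* *m X) 0 j)) | j <- enum 'I_n].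

(* Singular values are numbered from 1; the default value of [nth] provides the
   convention that the (n+1)-st one is 0. *)
Definition sigma (R : realType) (m n : nat) (X : 'M[R[i]]_(m, n)) (k : nat) : R :=
  nth 0 (singular_values X) k.-1.

Definition norm2 (R : realType) (m n : nat) (X : 'M[R[i]]_(m, n)) : R := sigma X 1.

Lemma size_singular_values (R : realType) (m n : nat) (X : 'M[R[i]]_(m, n)) :
  size (singular_values X) = n.
Proof. by rewrite size_sort size_map size_enum_ord. Qed.

Lemma sigma_ge0 (R : realType) (m n : nat) (X : 'M[R[i]]_(m, n)) (k : nat) :
  0 <= sigma X k.
Proof.
rewrite /sigma; case: (ltnP k.-1 (size (singular_values X))) => [lt_k|ge_k].
  have := mem_nth 0 lt_k; rewrite mem_sort => /mapP[j _ ->].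
  exact: sqrtr_ge0.
by rewrite nth_default.
Qed.

Lemma epsrank_exists (R : realType) (m n : nat) (X : 'M[R[i]]_(m, n)) (eps : R) :
  0 < eps < 1 -> exists k, sigma X k.+1 <= eps * norm2 X.
Proof.
move=> /andP[eps_gt0 _]; exists n.
rewrite /sigma nth_default ?size_singular_values //.
by rewrite mulr_ge0 ?sigma_ge0 // ltW.
Qed.

Definition epsrank (R : realType) (m n : nat) (X : 'M[R[i]]_(m, n)) (eps : R)
    (heps : 0 < eps < 1) : nat :=
  ex_minn (epsrank_exists X heps).

Definition krylov (R : realType) (m n : nat) (A : 'M[R[i]]_m) (w : 'cV[R[i]]_m) :
    'M[R[i]]_(m, n) :=
  \matrix_(i < m, j < n) (A ^+ j *m w) i 0.

(* Main.v *)
Require Import Defs.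
From mathcomp Require Import all_boot all_order all_algebra.
From mathcomp Require Import sesquilinear spectral complex.
From mathcomp Require Import all_classical all_reals all_analysis.
From mathcomp Require Import ring lra zify.

(** Write [N = 2 * n./2] and identify a vector supported on the first [N]
    coordinates with a polynomial [p] of degree less than [N]. As [A] is
    Hermitian, [|K v|^2] is a weighted sum of [|p(x)|^2] over the real
    eigenvalues [x] of [A] ([krylov_coefcol]), while [|v|^2] is the mean of
    [|p(w)|^2] over the [N] roots [w] of [X^N = -1] ([parseval]). So suppose that
    polynomials [f] and [g] of degree at most [2 k] satisfy [|f| <= 2 |g|] on the
    real line and [|g| <= b |f|] at the roots of [X^N = -1]. For [p = f q] we
    get [|K p| <= 2 |K (g q)| <= 2 sigma_1 |g q| <= 2 b sigma_1 |p|]. These [p]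
    form a space of codimension at most [2 k + 1] in dimension [n], so the
    min-max principle gives [sigma_(2 k + 2) <= 2 b sigma_1]
    ([sigma_krylov_le]).

    For [f] and [g] take [f = P^2 + xi^2 Q^2] and [g = P Q], where [P] and [Q] have
    conjugate roots on the unit circle and [xi] is the product of the roots of
    [P]. On the real line [|P| = |Q|]. On the unit circle [P / (xi Q)] is real: if
    the Cayley transform takes the point to [x] and the roots of [P] to
    [a_1, ..., a_k], it is the product of the [(x - a_j) / (x + a_j)], and the
    bound at the roots of [X^N = -1] becomes a bound on this product, or on its
    inverse, for [pi / (2 N) <= |x| <= 2 N / pi]. This is Zolotarev's problem
    ([zolotarev]).

    The problem is solved with Gaussian sums. Let [theta c z] be the sum of the
    [exp (- c (z - a)^2)] over the integers [a], let [theta_ratio c u] be the quotient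
    of [theta c] at [u] and at [u - 1/2], and let [alt_ratio c z] be the alternating
    sum of the same Gaussians divided by [theta c z]. Rotating the lattice of
    pairs of integers by 45 degrees ([thetaM]) gives, for [D = theta_ratio (2 c)],
    [alt_ratio c (u + v) * alt_ratio c (u - v)
       = (D u - 1 / D v) / (D u + 1 / D v)]
    ([alt_ratioM]). Hence, if [x = D u] and the [a_j] are the [1 / D v_j] at
    equally spaced [v_j], the product above is a product of [alt_ratio c] over
    equally spaced points. The Jacobi triple product turns [alt_ratio c] into a
    product of hyperbolic tangents over the shifted integer lattice
    ([alt_ratio_lim]), so that equally spaced points refine the lattice and the
    product is at most [rho (c / (2 k))], where [rho c = alt_ratio c 0]
    ([alt_ratio_collapse]).

    It remains to see that [rho c <= 2 exp (- pi^2 / (4 c))]. From the identity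
    above, [(rho c / 2)^2 <= rho (c / 2) / 2] ([rho_sqr_le]), so [c log (rho c / 2)]
    increases along [c, c / 2, c / 4, ...]; as [c] tends to 0 the logarithm of the
    product of hyperbolic tangents is governed by the sum of the reciprocals of the
    odd squares, which is [pi^2 / 8], and the limit is [- pi^2 / 4]
    ([rho_le_expR]). *)

Set Implicit Arguments.
Unset Strict Implicit.
Unset Printing Implicit Defensive.

Import Order.TTheory GRing.Theory Num.Theory.
Import numFieldNormedType.Exports.
Local Open Scope classical_set_scope.
Local Open Scope ring_scope.

(** * Sums over the integers *)

Section Esum.
Variable R : realType.
Local Open Scope ereal_scope.

Lemma esumZl (T : choiceType) (I : set T) (a : T -> \bar R) (r : R) :
  (0 <= r)%R -> (forall i, 0 <= a i) ->
  \esum_(i in I) (r%:E * a i) = r%:E * \esum_(i in I) a i.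
Proof.
move=> r0 a0.
have le_Zl (s : R) (b : T -> \bar R) : (0 <= s)%R -> (forall i, 0 <= b i) ->
    \esum_(i in I) (s%:E * b i) <= s%:E * \esum_(i in I) b i.
  move=> s0 b0; apply: ge_ereal_sup => _ [X [finX XI] <-].
  rewrite fsbig_finite//= -ge0_sume_distrr//; apply: lee_wpmul2l => //.
  by rewrite -fsbig_finite//; apply: ereal_sup_ubound; exists X.
have [->|rn0] := eqVneq r 0%R.
  by rewrite mul0e esum1// => i _; rewrite mul0e.
apply/eqP; rewrite eq_le le_Zl//=.
have -> : \esum_(i in I) a i = \esum_(i in I) (r^-1%:E * (r%:E * a i)).
  by apply: eq_esum => i _; rewrite muleA -EFinM mulVf// mul1e.
apply: le_trans (lee_wpmul2l _ (le_Zl _ _ _ _)) _; rewrite ?lee_fin ?invr_ge0//.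
  by move=> i; rewrite mule_ge0.
by rewrite muleA -EFinM divff// mul1e.
Qed.

Lemma esumM (T T' : choiceType) (a : T -> R) (b : T' -> R) :
  (forall i, 0 <= a i)%R -> (forall i, 0 <= b i)%R ->
  \esum_(j in [set: T']) (b j)%:E < +oo ->
  (\esum_(i in [set: T]) (a i)%:E) * (\esum_(j in [set: T']) (b j)%:E) =
  \esum_(k in [set: T * T']) (a k.1 * b k.2)%:E.
Proof.
move=> a0 b0 bfin.
have bE : (\esum_(j in [set: T']) (b j)%:E) \is a fin_num.
  by rewrite ge0_fin_numE// esum_ge0// => i _; rewrite lee_fin.
have -> : [set: T * T'] = [set: T] `*`` (fun=> [set: T']).
  by apply/seteqP; split.
rewrite -(@esum_esum _ _ _ _ _ (fun i j => (a i * b j)%:E)); last first.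
  by move=> i j _ _; rewrite lee_fin mulr_ge0.
have fb0 : (0 <= fine (\esum_(j in [set: T']) (b j)%:E))%R.
  by rewrite fine_ge0// esum_ge0// => i _; rewrite lee_fin.
rewrite -(fineK bE) muleC -esumZl//.
by apply: eq_esum => i _; rewrite (fineK bE) muleC -esumZl//.

Qed.

(** The first term collects the pairs whose entries have the same parity, the
    second one the others. *)
Lemma esum_int_rot (F : int * int -> \bar R) : (forall k, 0 <= F k) ->
  \esum_(k in [set: int * int]) F k =
  (\esum_(k in [set: int * int]) F (k.1 + k.2, k.1 - k.2)%R) +
  \esum_(k in [set: int * int]) F (k.1 + k.2 + 1, k.1 - k.2)%R.
Proof.
move=> F0; pose e1 (k : int * int) : int * int := (k.1 + k.2, k.1 - k.2)%R.
pose e2 (k : int * int) : int * int := (k.1 + k.2 + 1, k.1 - k.2)%R.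
rewrite (esumID (e1 @` setT))// !setTI.
have -> : ~` (e1 @` setT) = e2 @` setT.
  apply/seteqP; split=> [[k l] /= kl|_ [[a b] _ <-] [[a' b'] _ []] /=]; last by lia.
  have [[m [b kE]]|kl1] := EM (exists (m b : int), k = m + b /\ l = m - b)%R.
    by case: kl; exists (m, b) => //; rewrite /e1 /= kE.1 kE.2.
  exists (((k + l)%R %/ 2)%Z, ((k - l)%R %/ 2)%Z) => //; rewrite /e2 /=.
  case: (boolP (2 %| (k + l)%R)%Z) => h; last by congr pair; lia.
  by case: kl1; exists ((k + l)%R %/ 2)%Z, ((k - l)%R %/ 2)%Z; lia.
by congr (_ + _); rewrite esum_image//= => -[a b] [a' b'] _ _ [] *;
  congr pair; lia.
Qed.

Lemma esum_int (g : int -> R) : (forall a, 0 <= g a)%R ->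
  \esum_(a in [set: int]) (g a)%:E =
  (\sum_(n <oo) (g (Posz n))%:E) + \sum_(n <oo) (g (Negz n))%:E.
Proof.
move=> g0; rewrite (esumID (Posz @` setT)); last by move=> *; rewrite lee_fin.
rewrite !setTI; have -> : ~` (Posz @` setT) = Negz @` setT.
  apply/seteqP; split=> [[n|n] /= h|_ [n _ <-] [m _]//]; last by exists n.
  by case: h; exists n.
rewrite !esum_image//; try by move=> x y _ _ [].
by rewrite -!nneseries_esumT// => n; rewrite lee_fin.
Qed.

End Esum.

Section SumZ.
Variable R : realType.

(** Only used for summable nonnegative families, where [fine] loses nothing. *)
Definition sumZ (g : int -> R) : R := fine (\esum_(a in [set: int]) (g a)%:E).

(** The sum over [- M <= a <= M]; this indexing is the one of the powers in a
    Laurent polynomial of degree [M]. *)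
Definition symsum (M : nat) (g : int -> R) : R :=
  \sum_(i < M.*2.+1) g (i%:Z - M%:Z).

Lemma geometric_tail (q : R) (M N : nat) : 0 <= q < 1 ->
  \sum_(M <= n < N) q ^+ n <= q ^+ M / (1 - q).
Proof.
move=> /andP[q0 q1]; have q1' : 0 < 1 - q by rewrite subr_gt0.
rewrite ler_pdivlMr//; case: (leqP M N) => [MN|NM]; last first.
  by rewrite big_geq 1?ltnW// mul0r exprn_ge0.
have -> : (\sum_(M <= n < N) q ^+ n) * (1 - q) = q ^+ M - q ^+ N.
  rewrite -(subnKC MN); elim: (N - M)%N => [|m IH]; first by rewrite addn0 big_geq// mul0r subrr.
  rewrite addnS big_nat_recr ?leq_addr//= mulrDl IH exprS; ring.
by rewrite gerBl exprn_ge0.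
Qed.

Variables (g : int -> R) (K q : R).
Hypotheses (q01 : 0 <= q < 1) (g0 : forall a, 0 <= g a)
  (gq : forall a, g a <= K * q ^+ `|a|%N).

Let K0 : 0 <= K.
Proof. by have := gq 0; rewrite expr0 mulr1; apply: le_trans. Qed.

(** Both halves of a sum over the integers are series over [nat] dominated by
    the same geometric series. *)
Let side (s : nat -> int) (hs : forall n, (n <= `|s n|)%N) :
  exists2 l : R, (\sum_(n <oo) (g (s n))%:E)%E = l%:E &
    forall M, \sum_(n < M) g (s n) <= l <= \sum_(n < M) g (s n) + K * q ^+ M / (1 - q).
Proof.
case/andP: (q01) => q0 q1.
pose u N := \sum_(0 <= n < N) g (s n).
have u_nd : nondecreasing_seq u.
  by apply/nondecreasing_seqP => n; rewrite /u big_nat_recr//= lerDl.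
have gs n : g (s n) <= K * q ^+ n.
  by apply: le_trans (gq _) _; rewrite ler_wpM2l// ler_wiXn2l// ltW.
have uub M N : u N <= u M + K * q ^+ M / (1 - q).
  have tail0 : 0 <= K * q ^+ M / (1 - q).
    by rewrite divr_ge0 ?mulr_ge0 ?exprn_ge0// subr_ge0 ltW.
  case: (leqP M N) => [MN|NM]; last first.
    by rewrite (le_trans (u_nd _ _ (ltnW NM)))// lerDl.
  rewrite /u (big_cat_nat (n := M))//= lerD2l.
  apply: le_trans (_ : \sum_(M <= n < N) K * q ^+ n <= _); first exact: ler_sum.
  by rewrite -mulr_sumr -mulrA ler_wpM2l// geometric_tail.
have cu : cvgn u.
  apply: nondecreasing_is_cvgn => //; exists (u 0 + K * q ^+ 0 / (1 - q)).
  by move=> _ [N _ <-].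
exists (limn u).
  rewrite -EFin_lim//; congr (limn _); apply/funext => N /=.
  by rewrite /u sumEFin.
move=> M; rewrite -(big_mkord xpredT (fun n => g (s n))) -/(u M); apply/andP; split.
  exact: nondecreasing_cvgn_le.
by apply: limr_le => //; apply: nearW => N.
Qed.

(** The tail is explicit because it has to be uniform in a parameter of [g]. *)
Lemma sumZ_symsum : (\esum_(a in [set: int]) (g a)%:E)%E = (sumZ g)%:E /\
  forall M, symsum M g <= sumZ g <= symsum M g + K * (q ^+ M.+1 + q ^+ M) / (1 - q).
Proof.
have [l1 e1 h1] := @side Posz (fun n => leqnn n).
have [l2 e2 h2] := @side Negz (fun n => leqnSn n).
have E : (\esum_(a in [set: int]) (g a)%:E)%E = (l1 + l2)%:E.
  by rewrite esum_int// e1 e2.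
split; first by rewrite /sumZ E.
move=> M; rewrite /sumZ E /=.
have -> : symsum M g = \sum_(n < M.+1) g (Posz n) + \sum_(n < M) g (Negz n).
  rewrite /symsum -(big_mkord xpredT (fun i => g (i%:Z - M%:Z))).
  rewrite (big_cat_nat (n := M))//=; last by lia.
  rewrite addrC; congr (_ + _).
    rewrite -{1}[M]add0n big_addn -addnn -addSn addnK big_mkord.
    by apply: eq_bigr => i _; congr g; lia.
  rewrite big_nat_rev /= big_mkord; apply: eq_bigr => i _; congr g; have := ltn_ord i; lia.
have /andP[a1 a2] := h1 M.+1; have /andP[b1 b2] := h2 M.
rewrite lerD//=; apply: le_trans (lerD a2 b2) _; rewrite le_eqVlt; apply/orP; left; apply/eqP; ring.
Qed.

End SumZ.

(** * Gaussian sums over the integers *)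

Section Theta.
Variable R : realType.
Implicit Types c z x y u v : R.

Definition gauss c z (a : int) : R := expR (- (c * (z - a%:~R) ^+ 2)).

Definition theta c z : R := sumZ (gauss c z).

Lemma gauss_gt0 c z a : 0 < gauss c z a. Proof. exact: expR_gt0. Qed.

Lemma gauss_ge0 c z a : 0 <= gauss c z a. Proof. exact: expR_ge0. Qed.

Lemma expRN01 c : 0 < c -> 0 <= expR (- c) < 1.
Proof. by move=> c0; rewrite expR_ge0 expR_lt1 oppr_lt0. Qed.

(** Completing the square in [(|z - a| - 1)^2 >= 0] bounds [(z - a)^2] below by
    [|a| - |z| - 1]. *)
Lemma gauss_le c z a : 0 < c ->
  gauss c z a <= expR (c * (`|z| + 1)) * expR (- c) ^+ `|a|%N.
Proof.
move=> c0; rewrite /gauss -expRM_natl -expRD ler_expR.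
have eA : (`|a|%N)%:R = `|a%:~R| :> R by rewrite natr_absz -intr_norm.
rewrite eA -subr_ge0.
have -> : c * (`|z| + 1) + `|a%:~R| * - c - - (c * (z - a%:~R) ^+ 2) =
  c * ((z - a%:~R) ^+ 2 - (`|a%:~R| - `|z| - 1)) by ring.
apply: mulr_ge0; first exact: ltW.
have := lerB_normD a%:~R (- z); rewrite normrN distrC => h1.
have h2 : `|z - a%:~R| ^+ 2 = (z - a%:~R) ^+ 2 by rewrite real_normK ?num_real.
by rewrite -h2; have := sqr_ge0 (`|z - a%:~R| - 1); nra.
Qed.

Lemma theta_esum c z : 0 < c ->
  (\esum_(a in [set: int]) (gauss c z a)%:E)%E = (theta c z)%:E.
Proof.
move=> c0; apply: (sumZ_symsum (expRN01 c0) (gauss_ge0 c z) _).1 => a.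
exact: gauss_le.
Qed.

Lemma theta_gt0 c z : 0 < c -> 0 < theta c z.
Proof.
move=> c0; have := (sumZ_symsum (expRN01 c0) (gauss_ge0 c z) (fun a => gauss_le z a c0)).2 0.
move=> /andP[+ _]; apply: lt_le_trans.
by rewrite /symsum big_ord_recl big_ord0 addr0 gauss_gt0.
Qed.

Lemma thetaD1 c z : 0 < c -> theta c (z + 1) = theta c z.
Proof.
move=> c0; apply: EFin_inj; rewrite -!theta_esum//.
rewrite (reindex_esum setT _ (fun a => a + 1)%R); last first.
  split=> //; first by move=> a b _ _; apply: addIr.
  by move=> a _; exists (a - 1)%R => //; rewrite subrK.
by apply: eq_esum => a _; rewrite /gauss rmorphD /=; congr (expR (- (_ * _ ^+ 2)))%:E; ring.
Qed.

(** Since [(u + v - k)^2 + (u - v - l)^2] is twice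
    [(u - (k + l) / 2)^2 + (v - (k - l) / 2)^2], the double sum can be taken over
    [k + l] and [k - l], which are both even or both odd; these two cases give the
    two terms. *)
Lemma thetaM c u v : 0 < c ->
  theta c (u + v) * theta c (u - v) =
  theta (2 * c) u * theta (2 * c) v + theta (2 * c) (u - 2^-1) * theta (2 * c) (v - 2^-1).
Proof.
move=> c0; have c20 : 0 < 2 * c by rewrite mulr_gt0.
have M b x y (b0 : 0 < b) : (theta b x * theta b y)%:E =
    (\esum_(k in [set: int * int]) (gauss b x k.1 * gauss b y k.2)%:E)%E.
  rewrite EFinM -!theta_esum// esumM//; try exact: gauss_ge0.
  by rewrite theta_esum// ltry.
apply: EFin_inj; rewrite EFinD !M// esum_int_rot; last first.
  by move=> k; rewrite lee_fin mulr_ge0 ?gauss_ge0.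
congr (_ + _)%E; apply: eq_esum => -[a b] _ /=; congr _%:E;
  rewrite /gauss -!expRD; congr expR; rewrite ?(rmorphD, rmorphB, rmorphN) /=; by field.
Qed.

(** Even and odd integers. *)
Lemma theta_parity c z : 0 < c ->
  theta c z = theta (4 * c) (z / 2) + theta (4 * c) (z / 2 - 2^-1).
Proof.
move=> c0; have c40 : 0 < 4 * c by rewrite mulr_gt0.
apply: EFin_inj; rewrite EFinD -!theta_esum//.
rewrite (esumID ((fun a : int => 2 * a)%R @` setT)); last first.
  by move=> a _; rewrite lee_fin gauss_ge0.
rewrite !setTI.
have -> : ~` ((fun a : int => 2 * a)%R @` setT) = (fun a : int => 2 * a + 1)%R @` setT.
  apply/seteqP; split=> [a /= h|_ [b _ <-] [d _ /=]]; last by lia.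
  by exists (a %/ 2)%Z => //; case: (boolP (2 %| a)%Z) => ?; [case: h; exists (a %/ 2)%Z|]; lia.
rewrite !esum_image; try by move=> a b _ _; lia.
congr (_ + _)%E; apply: eq_esum => a _; congr _%:E;
  rewrite /gauss; congr (expR (- _)); rewrite ?(rmorphD, rmorphM) /=; by field.
Qed.

End Theta.

Section ThetaContinuity.
Variable R : realType.
Implicit Types c z : R.

Lemma tail_small (K q e : R) : 0 <= K -> 0 <= q < 1 -> 0 < e ->
  \forall M \near \oo, K * (q ^+ M.+1 + q ^+ M) / (1 - q) <= e.
Proof.
move=> K0 /andP[q0 q1] e0.
have q1' : 0 < 1 - q by rewrite subr_gt0.
have cq : (q ^+ n) @[n --> \oo] --> (0 : R) by apply: cvg_expr; rewrite ger0_norm.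
have e'0 : 0 < e * (1 - q) / (2 * K + 1) by rewrite divr_gt0 ?mulr_gt0//; lra.
move/cvgrPdist_le : cq => /(_ _ e'0); apply: filterS => M.
rewrite sub0r normrN ger0_norm ?exprn_ge0// => hM.
rewrite ler_pdivrMr//; rewrite ler_pdivlMr in hM; last by lra.
apply: le_trans hM; rewrite exprS.
have qM : 0 <= q ^+ M by rewrite exprn_ge0.
have : q * q ^+ M <= q ^+ M by rewrite ler_piMl// ltW.
nra.
Qed.

Lemma gauss_continuous c a : continuous (gauss c ^~ a).
Proof.
move=> z; have h : - (c * (y - a%:~R) ^+ 2) @[y --> z] --> - (c * (z - a%:~R) ^+ 2).
  apply: cvgN; apply: cvgM; first exact: cvg_cst.
  have h : y - a%:~R @[y --> z] --> z - a%:~R by apply: cvgB; [exact: cvg_id|exact: cvg_cst].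
  exact: (cvg_comp _ _ h (@exprn_continuous R 2 _)).
exact: (cvg_comp _ _ h (@continuous_expR R _)).
Qed.

(** The partial sums converge uniformly on [|y - z| <= 1]. *)
Lemma theta_continuous c : 0 < c -> continuous (theta c).
Proof.
move=> c0 z; set q := expR (- c); set K := expR (c * (`|z| + 2)).
have q01 : 0 <= q < 1 := expRN01 c0.
have tail y M : `|y - z| <= 1 ->
    `|theta c y - symsum M (gauss c y)| <= K * (q ^+ M.+1 + q ^+ M) / (1 - q).
  move=> yz; have bnd a : gauss c y a <= K * q ^+ `|a|%N.
    apply: le_trans (gauss_le _ _ c0) _; rewrite ler_wpM2r ?exprn_ge0 ?expR_ge0//.
    rewrite ler_expR ler_pM2l//; have := ler_normD (y - z) z; rewrite subrK; lra.
  have /andP[h1 h2] := (sumZ_symsum q01 (gauss_ge0 c y) bnd).2 M.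
  by rewrite ger0_norm ?subr_ge0// /theta; lra.
apply/cvgrPdist_le => e e0.
have e3 : 0 < e / 3 by lra.
have [M _ hM] := tail_small (expR_ge0 (c * (`|z| + 2))) q01 e3.
have {hM} hM := hM M (leqnn M); rewrite -/q -/K in hM.
have cS : symsum M (gauss c y) @[y --> z] --> symsum M (gauss c z).
  rewrite /symsum; apply: cvg_big => [|i _]; first exact: add_continuous.
  exact: gauss_continuous.
move/cvgrPdist_le : cS => /(_ _ e3) cS.
near=> y.
have yz : `|y - z| <= 1.
  rewrite distrC; near: y.
  have /cvgrPdist_le : y @[y --> z] --> z by exact: cvg_id.
  exact.
have h1 := tail y M yz.
have h2 : `|theta c z - symsum M (gauss c z)| <= e / 3.
  by apply: le_trans (tail z M _) hM; rewrite subrr normr0.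
have h3 : `|symsum M (gauss c z) - symsum M (gauss c y)| <= e / 3 by near: y.
have -> : theta c z - theta c y = (theta c z - symsum M (gauss c z)) +
   (symsum M (gauss c z) - symsum M (gauss c y)) - (theta c y - symsum M (gauss c y)) by ring.
have := ler_normD ((theta c z - symsum M (gauss c z)) +
   (symsum M (gauss c z) - symsum M (gauss c y))) (- (theta c y - symsum M (gauss c y))).
have := ler_normD (theta c z - symsum M (gauss c z))
   (symsum M (gauss c z) - symsum M (gauss c y)).
rewrite normrN; lra.
Unshelve. all: by end_near.
Qed.

End ThetaContinuity.

(** * The finite Jacobi triple product *)

Section QBinomial.
Variable R : realType.
Implicit Types c z t : R.

(** Gaussian binomial coefficients, by the Pascal rule, so that they vanish for
    [k > n]. *)
Fixpoint qbin (Q : R) (n k : nat) : R :=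
  match n, k with
  | _, 0 => 1
  | 0, _.+1 => 0
  | n'.+1, k'.+1 => qbin Q n' k'.+1 + Q ^+ (n' - k') * qbin Q n' k'
  end.

Definition qfact (Q : R) (n : nat) : R := \prod_(i < n) (1 - Q ^+ i.+1).

Lemma qbin0 Q n : qbin Q n 0 = 1. Proof. by case: n. Qed.

Lemma qbin_small Q n k : (n < k)%N -> qbin Q n k = 0.
Proof.
elim: n k => [|n IH] [|k]//= nk; rewrite !IH ?mulr0 ?addr0//; exact: ltnW.
Qed.

Theorem qbinomial Q t n :
  \prod_(i < n) (1 + Q ^+ i * t) =
  \sum_(k < n.+1) qbin Q n k * Q ^+ 'C(k, 2) * t ^+ k.
Proof.
elim: n => [|n IH]; first by rewrite big_ord0 big_ord_recl big_ord0 /= bin_small// !expr0; ring.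
rewrite big_ord_recr /= IH mulrDr mulr1 [RHS]big_ord_recl /= bin_small// !expr0 !mulr1.
under [in RHS]eq_bigr do rewrite /bump /= add1n !mulrDl.
rewrite big_split /= addrA; congr (_ + _).
  rewrite [RHS]addrC [in RHS]big_ord_recr /= qbin_small// !mul0r addr0.
  by rewrite big_ord_recl /= qbin0 bin_small// !expr0 !mulr1 addrC.
rewrite mulr_suml; apply: eq_bigr => i _.
have -> : (Q ^+ n = Q ^+ (n - i) * Q ^+ i) by rewrite -exprD subnK// -ltnS.
rewrite binS bin1 exprD exprS; ring.
Qed.

End QBinomial.

Section QBinomialBounds.
Variables (R : realType) (Q : R).
Hypothesis Q01 : 0 <= Q < 1.

Let Q0 : 0 <= Q. Proof. by case/andP: Q01. Qed.
Let Q1 : Q < 1. Proof. by case/andP: Q01. Qed.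

Let f01 n : 0 < 1 - Q ^+ n.+1 <= 1.
Proof. by rewrite subr_gt0 exprn_ilt1// gerBl exprn_ge0. Qed.

Lemma qfactS n : qfact Q n.+1 = qfact Q n * (1 - Q ^+ n.+1).
Proof. by rewrite /qfact big_ord_recr. Qed.

Lemma qfact_gt0 n : 0 < qfact Q n.
Proof. by apply: prodr_gt0 => i _; case/andP: (f01 i). Qed.

Lemma qfact_ge0 n : 0 <= qfact Q n. Proof. exact/ltW/qfact_gt0. Qed.

Lemma qfact_le m n : (m <= n)%N -> qfact Q n <= qfact Q m.
Proof.
move=> /subnKC <-; elim: (n - m)%N => [|k IH]; first by rewrite addn0.
rewrite addnS qfactS; apply: le_trans IH; apply: ler_piMr; first exact: qfact_ge0.
by case/andP: (f01 (m + k)).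
Qed.

Lemma qbinE n k : (k <= n)%N -> qbin Q n k = qfact Q n / (qfact Q k * qfact Q (n - k)).
Proof.
have qn m : qfact Q m != 0 by rewrite gt_eqF// qfact_gt0.
have q1 : qfact Q 0 = 1 by rewrite /qfact big_ord0.
elim: n k => [|n IH] [|k]//= kn; first by rewrite q1 mulr1 divr1.
  by rewrite q1 mul1r subn0 divff.
rewrite (IH k)// subSS; move: kn; rewrite leq_eqVlt => /orP[/eqP [->]|kn].
  by rewrite qbin_small// subnn q1 expr0 !mulr1 mul1r divff// add0r divff.
rewrite (IH k.+1)// -[(n - k)%N]prednK ?subn_gt0// -subnS !qfactS.
have e : n.+1 = (k.+1 + (n - k.+1).+1)%N by lia.
have -> : Q ^+ n.+1 = Q ^+ k.+1 * Q ^+ (n - k.+1).+1 by rewrite -exprD -e.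
have := lt0r_neq0 (andP (f01 k)).1; have := lt0r_neq0 (andP (f01 (n - k.+1))).1.
move: (qn n) (qn k) (qn (n - k.+1)%N).
move: (qfact _ _) (qfact _ _) (qfact _ _) (Q ^+ _) (Q ^+ _) => x y w a b *.
by field; repeat (apply/andP; split).
Qed.

(** The product on the right increases with [j]. *)
Lemma qbin_ratio_le M j : (j <= M)%N ->
  qfact Q M ^+ 2 <= qfact Q (M + j) * qfact Q (M - j).
Proof.
elim: j => [|j IH] jM; first by rewrite addn0 subn0 expr2.
apply: le_trans (IH (ltnW jM)) _; rewrite addnS qfactS.
rewrite -[(M - j)%N]prednK ?subn_gt0// -subnS qfactS.
rewrite -mulrA ler_wpM2l ?qfact_ge0// mulrC ler_wpM2r ?qfact_ge0//.
rewrite lerD2l lerN2; apply: ler_wiXn2l => //; [exact: ltW|lia].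
Qed.

(** The quotient of the two factorials is a product of [j] factors
    [1 - Q ^+ i] with [i > M - j]. *)
Lemma bernoulli_prod M j : (j <= M)%N ->
  (1 - j%:R * Q ^+ (M - j).+1) * qfact Q (M - j) <= qfact Q M.
Proof.
elim: j => [|j IH] jM; first by rewrite mul0r subr0 mul1r subn0.
apply: le_trans (IH (ltnW jM)).
rewrite -[(M - j)%N]prednK ?subn_gt0// -subnS qfactS mulrA mulrAC.
apply: ler_wpM2r; first exact: qfact_ge0.
set a := Q ^+ (M - j.+1).+1; set b := Q ^+ (M - j.+1).+2.
have a0 : 0 <= a by apply: exprn_ge0.
have ba : b <= a by apply: ler_wiXn2l => //; exact: ltW.
have b0 : 0 <= b by apply: exprn_ge0.
have j0 : 0 <= (j%:R : R) by [].
have h1 : 0 <= j%:R * (a * b) by rewrite !mulr_ge0.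
have h2 : j%:R * b <= j%:R * a by rewrite ler_wpM2l.
rewrite -natr1; lra.
Qed.

Lemma qbin_ratio_ge M j : (j <= M)%N ->
  (1 - j%:R * Q ^+ (M - j).+1) * (qfact Q (M + j) * qfact Q (M - j)) <= qfact Q M ^+ 2.
Proof.
move=> jM; rewrite mulrCA expr2; apply: le_trans (_ : qfact Q (M + j) * qfact Q M <= _).
  by apply: ler_wpM2l; [exact: qfact_ge0|exact: bernoulli_prod].
by apply: ler_wpM2r; [exact: qfact_ge0|apply: qfact_le; rewrite leq_addr].
Qed.
End QBinomialBounds.

Section WeightedSum.
Variables (R : realType) (Q : R).
Hypothesis Q01 : 0 <= Q < 1.

(** Coefficient of degree [k - M] in the finite triple product, up to its
    Gaussian factor and relative to the central coefficient. It lies between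
    0 and 1 and tends to 1 when [k - M] is fixed. *)
Definition qweight (M k : nat) : R := qbin Q M.*2 k / qbin Q M.*2 M.

Lemma qbin_gt0 n k : (k <= n)%N -> 0 < qbin Q n k.
Proof. by move=> kn; rewrite qbinE// divr_gt0 ?mulr_gt0 ?qfact_gt0. Qed.

Lemma qweightE M k : (k <= M.*2)%N ->
  qweight M k = qfact Q M ^+ 2 / (qfact Q k * qfact Q (M.*2 - k)).
Proof.
move=> kM; rewrite /qweight !qbinE//; last by lia.
have -> : (M.*2 - M = M)%N by lia.
have qn m : qfact Q m != 0 by rewrite gt_eqF// qfact_gt0.
by field; rewrite !qn.
Qed.

Lemma qweight_bounds M j : (j <= M)%N ->
  1 - j%:R * Q ^+ (M - j).+1 <= qfact Q M ^+ 2 / (qfact Q (M + j) * qfact Q (M - j)) <= 1.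
Proof.
move=> jM; have pos : 0 < qfact Q (M + j) * qfact Q (M - j) by rewrite mulr_gt0 ?qfact_gt0.
by rewrite ler_pdivlMr// ler_pdivrMr// mul1r qbin_ratio_le// qbin_ratio_ge.
Qed.

Lemma qweight_itv M k : (k <= M.*2)%N -> 0 <= qweight M k <= 1.
Proof.
move=> kM; apply/andP; split.
  by rewrite /qweight divr_ge0// ltW ?qbin_gt0//; lia.
rewrite qweightE//; case: (leqP M k) => h.
  have /andP[_] := @qweight_bounds M (k - M) ltac:(lia).
  by rewrite subnKC// (_ : M - (k - M) = M.*2 - k)%N//; lia.
have /andP[_] := @qweight_bounds M (M - k) ltac:(lia).
rewrite (_ : M - (M - k) = k)%N; last by lia.
by rewrite (_ : M + (M - k) = M.*2 - k)%N 1?[qfact Q (_ - _) * _]mulrC//; lia.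
Qed.

Lemma qweight_ge M J k : (J <= M)%N -> (M - J <= k <= M + J)%N ->
  1 - J%:R * Q ^+ (M - J).+1 <= qweight M k.
Proof.
move=> JM kJ; have [Q0 Q1] := andP Q01.
have mono j : (j <= J)%N -> 1 - J%:R * Q ^+ (M - J).+1 <= 1 - j%:R * Q ^+ (M - j).+1.
  move=> jJ; rewrite lerD2l lerN2 ler_pM ?exprn_ge0 ?ler_nat//.
  by apply: ler_wiXn2l => //; [exact: ltW|lia].
rewrite qweightE; last by lia.
have [j jJ -> ] : exists2 j, (j <= J)%N &
    qfact Q k * qfact Q (M.*2 - k) = qfact Q (M + j) * qfact Q (M - j).
  case: (leqP M k) => h; [exists (k - M)%N|exists (M - k)%N]; try by lia.
    by congr (qfact Q _ * qfact Q _); lia.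
  by rewrite mulrC; congr (qfact Q _ * qfact Q _); lia.
apply: le_trans (mono _ jJ) _.
by have /andP[] := @qweight_bounds M j ltac:(lia).
Qed.

Definition wsum (M : nat) (g : int -> R) : R :=
  \sum_(k < M.*2.+1) qweight M k * g (k%:Z - M%:Z).

(** Dominated convergence, by hand: the weights are at most 1, and those of the
    [J] central terms on each side are uniformly close to 1. *)
Lemma wsum_cvg (g : int -> R) (K q : R) : 0 <= q < 1 -> (forall a, 0 <= g a) ->
  (forall a, g a <= K * q ^+ `|a|%N) -> wsum M g @[M --> \oo] --> sumZ g.
Proof.
move=> q01 g0 gq; have [Q0 Q1] := andP Q01.
have hS := (sumZ_symsum q01 g0 gq).2.
have S0 : 0 <= sumZ g.
  by have /andP[+ _] := hS 0; apply: le_trans; apply: sumr_ge0.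
have K0 : 0 <= K by have := gq 0; rewrite expr0 mulr1; apply: le_trans.
have up M : wsum M g <= sumZ g.
  apply: le_trans (andP (hS M)).1; apply: ler_sum => k _.
  by rewrite ler_piMl//; case/andP: (@qweight_itv M k ltac:(have := ltn_ord k; lia)).
have low M J : (J <= M)%N -> (1 - J%:R * Q ^+ (M - J).+1) * symsum J g <= wsum M g.
  move=> JM; rewrite /wsum -(big_mkord xpredT (fun k => qweight M k * g (k%:Z - M%:Z))).
  have t0 a b : (b <= M.*2.+1)%N -> 0 <= \sum_(a <= k < b) qweight M k * g (k%:Z - M%:Z).
    move=> bM; rewrite big_nat_cond; apply: sumr_ge0 => k /andP[/andP[_ kb] _].
    by rewrite mulr_ge0//; case/andP: (@qweight_itv M k ltac:(lia)).
  rewrite (big_cat_nat (n := (M - J)%N))//=; last by lia.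
  rewrite (big_cat_nat (m := (M - J)%N) (n := (M + J).+1))//=; try by lia.
  apply: le_trans (_ : \sum_(M - J <= k < (M + J).+1) qweight M k * g (k%:Z - M%:Z) <= _).
    rewrite /symsum mulr_sumr -{2}[(M - J)%N]add0n big_addn.
    rewrite (_ : (M + J).+1 - (M - J) = J.*2.+1)%N; last by lia.
    rewrite big_mkord; apply: ler_sum => i _.
    rewrite (_ : (i + (M - J))%N%:Z - M%:Z = i%:Z - J%:Z); last by lia.
    by rewrite ler_wpM2r// qweight_ge//; have := ltn_ord i; lia.
  have := t0 0 (M - J)%N ltac:(lia); have := t0 (M + J).+1 M.*2.+1 ltac:(lia); lra.
apply/cvgrPdist_le => e e0.
have e2 : 0 < e / 2 by lra.
have [J _ /(_ J (leqnn J)) hJ] := tail_small K0 q01 e2.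
have cQ : J%:R * sumZ g * Q ^+ n @[n --> \oo] --> (0 : R).
  rewrite -[X in _ --> X](mulr0 (J%:R * sumZ g)); apply: cvgM; first exact: cvg_cst.
  by apply: cvg_expr; rewrite ger0_norm.
move/cvgrPdist_le : cQ => /(_ _ e2) [M0 _ hM0].
exists (M0 + J)%N => // M /= MJ.
have JM : (J <= M)%N by lia.
have := hM0 (M - J).+1 ltac:(rewrite /=; lia).
rewrite sub0r normrN ger0_norm ?mulr_ge0 ?exprn_ge0// => hq.
rewrite ger0_norm ?subr_ge0//.
have := low M J JM; have := andP (hS J) => -[h1 h2].
have : J%:R * Q ^+ (M - J).+1 * symsum J g <= J%:R * sumZ g * Q ^+ (M - J).+1.
  by rewrite mulrAC; apply: ler_wpM2r; rewrite ?exprn_ge0//; apply: ler_wpM2l.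
lra.
Qed.

End WeightedSum.

Section TripleProduct.
Variable R : realType.
Implicit Types c z s : R.

Let double_natr n : n.*2%:R = 2 * n%:R :> R.
Proof. by rewrite -mul2n natrM. Qed.

Let doubleS1 n : n.*2.+1%:R = 2 * n%:R + 1 :> R.
Proof. by rewrite -natr1 double_natr. Qed.

(** The [q]-binomial theorem for [2 M] factors, after taking the large exponential
    out of each of the first [M] of them. Completing the square in the exponents
    gives the Gaussians; [s = 1] yields [theta] and [s = -1] its alternating
    version. *)
Lemma triple_product c z s M : s ^+ 2 = 1 ->
  \prod_(m < M) ((1 + s * expR (2 * c * z - c * m.*2.+1%:R)) *
                 (1 + s * expR (- (2 * c * z) - c * m.*2.+1%:R))) =
  expR (c * z ^+ 2) * \sum_(k < M.*2.+1)
    qbin (expR (- (2 * c))) M.*2 k * s ^+ (k + M) * gauss c z (k%:Z - M%:Z).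
Proof.
move=> s2; set Q := expR (- (2 * c)).
have sM : s ^+ M * s ^+ M = 1 by rewrite -exprMn -expr2 s2 expr1n.
pose t := s * expR (2 * c * z + c * (M.*2%:R - 1)).
(* factor i < M, counted downwards, is s * E i times a factor of the triple product *)
pose E i : R := expR (2 * c * z + c * i.*2.+1%:R).
have prodE : \prod_(i < M) (s * E i) = s ^+ M * expR (2 * c * z * M%:R + c * M%:R ^+ 2).
  elim: (M) => [|m IH]; first by rewrite big_ord0 expr0 expr0n /= !mulr0 addr0 expR0 mulr1.
  rewrite big_ord_recr /= IH (exprSr s) mulrACA /E -expRD; congr (_ * expR _).
  rewrite doubleS1 -natr1; ring.
have qb := qbinomial Q t M.*2.
have QE i : Q ^+ i = expR (- (2 * c) * i%:R) by rewrite mulrC expRM_natl.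
have lhs : \prod_(i < M.*2) (1 + Q ^+ i * t) =
    (\prod_(i < M) (s * E i)) * \prod_(m < M) ((1 + s * expR (2 * c * z - c * m.*2.+1%:R)) *
                 (1 + s * expR (- (2 * c * z) - c * m.*2.+1%:R))).
  rewrite -(big_mkord xpredT (fun i => 1 + Q ^+ i * t)).
  rewrite (big_cat_nat (n := M))//=; last by lia.
  rewrite big_nat_rev /= add0n !big_mkord [X in _ = _ * X]big_split /= mulrCA [LHS]mulrC.
   congr (_ * _); last first.
    rewrite -big_split /=; apply: eq_bigr => i _.
    rewrite mulrDr mulr1 mulrACA -expr2 s2 mul1r -expRD.
    rewrite (_ : _ + _ + _ = 0); last by ring.
    rewrite expR0 addrC; congr (_ + _); rewrite QE /t mulrCA -expRD; congr (s * expR _).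
    rewrite natrB// doubleS1 double_natr -natr1; ring.
  rewrite -{1}[M]add0n big_addn -addnn addnK big_mkord; apply: eq_bigr => i _.
  congr (_ + _); rewrite QE /t mulrCA -expRD; congr (s * expR _).
  rewrite natrD doubleS1 double_natr; ring.
have E0 : expR (2 * c * z * M%:R + c * M%:R ^+ 2) != 0 by rewrite gt_eqF// expR_gt0.
set P := \prod_(m < M) ((1 + _) * _) in lhs *; set Z := expR (_ + _) in prodE E0.
have h : P * Z = s ^+ M * \sum_(k < M.*2.+1) qbin Q M.*2 k * Q ^+ 'C(k, 2) * t ^+ k.
  by rewrite -qb lhs prodE !mulrA sM mul1r mulrC.
apply: (mulIf E0); rewrite h mulrAC mulr_sumr [RHS]mulr_sumr; apply: eq_bigr => k _.
rewrite QE /t exprMn exprD /gauss -!expRM_natl.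
set a := qbin _ _ _.
suff hE : expR (- (2 * c) * 'C(k, 2)%:R) * expR (k%:R * (2 * c * z + c * (M.*2%:R - 1))) =
    expR (c * z ^+ 2) * Z * expR (- (c * (z - (k%:Z - M%:Z)%:~R) ^+ 2)).
  rewrite [LHS](_ : _ = a * (s ^+ k * s ^+ M) * (expR (- (2 * c) * 'C(k, 2)%:R) *
    expR (k%:R * (2 * c * z + c * (M.*2%:R - 1))))); last by ring.
  by rewrite hE; ring.
rewrite /Z -!expRD; congr expR.
have -> : - (2 * c) * 'C(k, 2)%:R = - c * (k%:R * (k%:R - 1)).
  have -> : k%:R * (k%:R - 1) = 2 * 'C(k, 2)%:R :> R; last by ring.
  case: (nat_of_ord k) => [|n]; first by rewrite bin_small// mulr0 mul0r.
  have := mul_bin_diag n.+1 1; rewrite bin1 /= => h2.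
  by rewrite -[n.+1%:R - 1](_ : n%:R = _) -1?natrM ?h2 ?natrM// -natr1 addrK.
rewrite double_natr rmorphB /=; ring.
Qed.

End TripleProduct.

(** * Ratios of theta functions *)

Section Tanh.
Variable R : realType.
Implicit Types c x y z u v : R.

Definition tanh x : R := (1 - expR (- (2 * x))) / (1 + expR (- (2 * x))).

Let den_gt0 x : 0 < 1 + expR (- (2 * x)).
Proof. by rewrite addr_gt0 ?expR_gt0. Qed.

Lemma tanhN x : tanh (- x) = - tanh x.
Proof.
rewrite /tanh mulrN opprK; have := expR_gt0 (2 * x); rewrite expRN.
move: (expR _) => e e0; field; rewrite !gt_eqF//; lra.
Qed.

Lemma normr_tanh_le1 x : `|tanh x| <= 1.
Proof.
rewrite /tanh normrM normfV [X in _ / X]gtr0_norm// ler_pdivrMr// mul1r.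
have := expR_gt0 (- (2 * x)); rewrite ler_norml; lra.
Qed.

Lemma tanh_ge0 x : 0 <= x -> 0 <= tanh x.
Proof.
move=> x0; apply: divr_ge0; last exact: ltW.
by rewrite subr_ge0 expR_le1; lra.
Qed.

(** In terms of hyperbolic cosines, the left-hand side is
    [(cosh 2x - cosh 2y) / (cosh 2x + cosh 2y)], which is largest for [y = 0]. *)
Lemma tanhM_le x y : `|y| <= x -> `|tanh (x - y) * tanh (x + y)| <= tanh x ^+ 2.
Proof.
rewrite ler_norml => /andP[xy yx].
have x0 : 0 <= x by lra.
rewrite ger0_norm; last by rewrite mulr_ge0 ?tanh_ge0//; lra.
rewrite /tanh; set p := expR (- (2 * x)); set r := expR (2 * y).
have p0 : 0 < p := expR_gt0 _. have r0 : 0 < r := expR_gt0 _.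
have -> : expR (- (2 * (x - y))) = p * r by rewrite -expRD; congr expR; ring.
have -> : expR (- (2 * (x + y))) = p / r by rewrite -expRN -expRD; congr expR; ring.
have e1 : (1 - p * r) * (1 - p / r) = 1 + p ^+ 2 - p * (r + r^-1) by field; rewrite gt_eqF.
have e2 : (1 + p * r) * (1 + p / r) = 1 + p ^+ 2 + p * (r + r^-1) by field; rewrite gt_eqF.
have S2 : 2 <= r + r^-1.
  rewrite -subr_ge0 (_ : _ - _ = (r - 1) ^+ 2 / r); last by field; rewrite gt_eqF.
  by rewrite divr_ge0 ?sqr_ge0 ?ltW.
rewrite mulf_div e1 e2 exprMn exprVn ler_pdivrMr; last by nra.
rewrite mulrAC ler_pdivlMr; last by rewrite exprn_gt0//; lra.
have : p * (1 + p ^+ 2) * 2 <= p * (1 + p ^+ 2) * (r + r^-1).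
  by rewrite ler_wpM2l// mulr_ge0 ?ltW//; nra.
move: (r + r^-1) => S h.
rewrite -subr_ge0 (_ : _ - _ = 2 * (p * (1 + p ^+ 2) * S - p * (1 + p ^+ 2) * 2)); last by ring.
lra.
Qed.

(** The sum of [(-1)^a exp (- c (z - a)^2)] over the integers [a], divided by the sum
    of the [exp (- c (z - a)^2)]: the two [theta] terms are the contributions of
    the even and of the odd integers. *)
Definition alt_ratio c z : R :=
  (theta (4 * c) (z / 2) - theta (4 * c) (z / 2 - 2^-1)) /
  (theta (4 * c) (z / 2) + theta (4 * c) (z / 2 - 2^-1)).

Definition gauss_even c z (a : int) : R := if (2 %| a)%Z then gauss c z a else 0.

Lemma gauss_even_ge0 c z a : 0 <= gauss_even c z a.
Proof. by rewrite /gauss_even; case: ifP; rewrite ?gauss_ge0. Qed.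

Lemma gauss_even_le c z a : gauss_even c z a <= gauss c z a.
Proof. by rewrite /gauss_even; case: ifP; rewrite ?gauss_ge0. Qed.

Lemma sumZ_gauss_even c z : 0 < c -> sumZ (gauss_even c z) = theta (4 * c) (z / 2).
Proof.
move=> c0; have c40 : 0 < 4 * c by rewrite mulr_gt0.
have h : (\esum_(a in [set: int]) (gauss_even c z a)%:E = (theta (4 * c) (z / 2))%:E)%E.
  rewrite -theta_esum//.
  transitivity (\esum_(a in (fun a : int => 2 * a)%R @` setT) (gauss c z a)%:E)%E.
    rewrite [RHS]esum_mkcond; apply: eq_esum => a _; rewrite /gauss_even.
    case: (boolP (2 %| a)%Z) => h; last rewrite memNset ?mem_set//.
      by rewrite mem_set//; exists (a %/ 2)%Z => //; lia.
    by move=> [b _ hb]; move: h; rewrite -hb; lia.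
  rewrite esum_image; last by move=> a b _ _; lia.
  apply: eq_esum => a _; congr _%:E.
  rewrite /gauss; congr (expR (- _)); rewrite rmorphM /=; by field.
by rewrite /sumZ h.
Qed.

(** The quotient of the finite triple products for [s = -1] and [s = 1]. *)
Lemma alt_ratio_lim c z : 0 < c ->
  \prod_(m < M) (tanh (c * (m%:R + 2^-1 - z)) * tanh (c * (m%:R + 2^-1 + z))) @[M --> \oo]
    --> alt_ratio c z.
Proof.
move=> c0; pose Q := expR (- (2 * c)).
have Q01 : 0 <= Q < 1 by apply: expRN01; rewrite mulr_gt0.
have lim1 := wsum_cvg Q01 (expRN01 c0) (gauss_ge0 c z) (fun a => gauss_le z a c0).
have lim2 := wsum_cvg Q01 (expRN01 c0) (gauss_even_ge0 c z)
  (fun a => le_trans (gauss_even_le c z a) (gauss_le z a c0)).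
rewrite -/(theta c z) in lim1; rewrite sumZ_gauss_even// in lim2.
have th0 := theta_gt0 z c0.
have -> : alt_ratio c z = (2 * theta (4 * c) (z / 2) - theta c z) / theta c z.
  by rewrite /alt_ratio -theta_parity//; congr (_ / _); rewrite (theta_parity z c0); ring.
rewrite (_ : (fun M => _) = fun M => (2 * wsum Q M (gauss_even c z) - wsum Q M (gauss c z)) / wsum Q M (gauss c z)).
  apply: cvgM; last by apply: cvgV => //; rewrite gt_eqF.
  by apply: cvgB => //; apply: cvgM => //; exact: cvg_cst.
apply/funext => M.
have hp := triple_product c z M (expr1n R 2).
have hm := triple_product c z M (etrans (sqrrN 1) (expr1n R 2)).
have b0 : qbin Q M.*2 M != 0 by rewrite gt_eqF// qbin_gt0//; lia.
have z0 : expR (c * z ^+ 2) != 0 by rewrite gt_eqF// expR_gt0.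
have E g : qbin Q M.*2 M * wsum Q M g = \sum_(k < M.*2.+1) qbin Q M.*2 k * g (k%:Z - M%:Z).
  by rewrite /wsum mulr_sumr; apply: eq_bigr => k _; rewrite /qweight; field.
have e1 : \sum_(k < M.*2.+1) qbin Q M.*2 k * 1 ^+ (k + M) * gauss c z (k%:Z - M%:Z) =
    qbin Q M.*2 M * wsum Q M (gauss c z).
  by rewrite E; apply: eq_bigr => k _; rewrite expr1n mulr1.
have e2 : \sum_(k < M.*2.+1) qbin Q M.*2 k * (- 1) ^+ (k + M) * gauss c z (k%:Z - M%:Z) =
    qbin Q M.*2 M * (2 * wsum Q M (gauss_even c z) - wsum Q M (gauss c z)).
  rewrite mulrBr mulrCA !E mulr_sumr -sumrB; apply: eq_bigr => k _.
  rewrite -signr_odd /gauss_even.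
  have -> : (2 %| (k%:Z - M%:Z)%R)%Z = ~~ odd (k + M) by lia.
  by case: (odd _) => /=; ring.
rewrite -/Q e1 in hp; rewrite -/Q e2 in hm.
set W1 := wsum Q M (gauss c z) in hp hm *; set W2 := wsum Q M _ in hm *.
have W10 : W1 != 0.
  have : expR (c * z ^+ 2) * (qbin Q M.*2 M * W1) != 0.
    rewrite -hp prodf_seq_neq0; apply/allP => m _ /=.
    by rewrite !mul1r mulf_neq0// gt_eqF// addr_gt0// expR_gt0.
  by rewrite !mulf_eq0 !negb_or => /andP[_ /andP[]].
transitivity ((expR (c * z ^+ 2) * (qbin Q M.*2 M * (2 * W2 - W1))) /
   (expR (c * z ^+ 2) * (qbin Q M.*2 M * W1))); last first.
  by field; rewrite W10 b0 z0.
rewrite -hp -hm -prodf_div; apply: eq_bigr => m _.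
rewrite -mulf_div; have e3 : (m.*2.+1)%:R = 2 * m%:R + 1 :> R by rewrite -natr1 -mul2n natrM.
have e4 : - (2 * (c * (m%:R + 2^-1 - z))) = 2 * c * z - c * (2 * m%:R + 1) by field.
have e5 : - (2 * (c * (m%:R + 2^-1 + z))) = - (2 * c * z) - c * (2 * m%:R + 1) by field.
by rewrite /tanh e3 e4 e5 !mul1r !mulN1r.
Qed.

End Tanh.

Section Quotient.
Variable R : realType.
Implicit Types c x y z u v : R.

Definition theta_ratio c u : R := theta c u / theta c (u - 2^-1).

Lemma theta_ratio_gt0 c u : 0 < c -> 0 < theta_ratio c u.
Proof. by move=> c0; rewrite divr_gt0 ?theta_gt0. Qed.

Lemma theta_shift c u : 0 < c -> theta c (u - 2^-1 - 2^-1) = theta c u.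
Proof. by move=> c0; rewrite -(thetaD1 (u - 2^-1 - 2^-1))//; congr theta; field. Qed.

Lemma theta_ratio_shift c u : 0 < c -> theta_ratio c (u - 2^-1) = (theta_ratio c u)^-1.
Proof. by move=> c0; rewrite /theta_ratio theta_shift// invf_div. Qed.

Lemma alt_ratioE c z : 0 < c -> alt_ratio c z =
  (theta_ratio (4 * c) (z / 2) - 1) / (theta_ratio (4 * c) (z / 2) + 1).
Proof.
move=> c0; have c40 : 0 < 4 * c by rewrite mulr_gt0.
rewrite /alt_ratio /theta_ratio; have h1 := theta_gt0 (z / 2) c40; have h2 := theta_gt0 (z / 2 - 2^-1) c40.
by field; rewrite !gt_eqF//; lra.
Qed.

(** The four products of values of [theta (4 c)] obtained by expanding the
    left-hand side are grouped by [thetaM] into two products of values of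
    [theta (2 c)]. *)
Lemma alt_ratioM c u v : 0 < c ->
  alt_ratio c (u + v) * alt_ratio c (u - v) =
  (theta_ratio (2 * c) u * theta_ratio (2 * c) v - 1) /
  (theta_ratio (2 * c) u * theta_ratio (2 * c) v + 1).
Proof.
move=> c0; have c20 : 0 < 2 * c by rewrite mulr_gt0.
have c40 : 0 < 4 * c by rewrite mulr_gt0.
have c4E : 4 * c = 2 * (2 * c) by ring.
set U := (u + v) / 2; set V := (u - v) / 2.
have uE : u = U + V by rewrite /U /V; field.
have vE : v = U - V by rewrite /U /V; field.
have M1 := thetaM U V c20; rewrite -uE -vE -c4E in M1.
have M2 := thetaM (U - 2^-1) V c20.
rewrite theta_shift ?mulr_gt0// -c4E in M2.
have e1 : U - 2^-1 + V = u - 2^-1 by rewrite uE; ring.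
have e2 : U - 2^-1 - V = v - 2^-1 by rewrite vE; ring.
rewrite e1 e2 in M2.
rewrite /alt_ratio /theta_ratio -/U -/V.
have := theta_gt0 u c20; have := theta_gt0 v c20.
have := theta_gt0 (u - 2^-1) c20; have := theta_gt0 (v - 2^-1) c20.
have := theta_gt0 U c40; have := theta_gt0 V c40.
have := theta_gt0 (U - 2^-1) c40; have := theta_gt0 (V - 2^-1) c40.
move: M1 M2; move: (theta _ u) (theta _ v) (theta _ (u - _)) (theta _ (v - _)).
move: (theta _ U) (theta _ V) (theta _ (U - _)) (theta _ (V - _)).
move=> a a' b b' du dv du' dv' M1 M2 b'0 b0 a'0 a0 dv'0 du'0 dv0 du0.
have n1 : a + b != 0 by rewrite gt_eqF// addr_gt0.
have n2 : a' + b' != 0 by rewrite gt_eqF// addr_gt0.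
have p0 : 0 < du * dv + du' * dv' by rewrite addr_gt0// mulr_gt0.
have -> : du / du' * (dv / dv') = (du * dv) / (du' * dv') by field; rewrite !gt_eqF.
have -> : (du * dv / (du' * dv') - 1) / (du * dv / (du' * dv') + 1) =
   (du * dv - du' * dv') / (du * dv + du' * dv').
  by field; rewrite !gt_eqF.
rewrite mulf_div M1 M2; congr (_ / _); ring.
Qed.

Definition rho c : R := alt_ratio c 0.

(** With [d = theta_ratio (2 * c) 0 >= 1], we have
    [rho c ^+ 2 = (d ^+ 2 - 1) / (d ^+ 2 + 1)] and
    [rho (c / 2) = (d - 1) / (d + 1)]; this is the Landen transformation of [rho]. *)
Lemma rho_sqr_le c : 0 < c -> 0 <= rho c /\ (rho c / 2) ^+ 2 <= rho (c / 2) / 2.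
Proof.
move=> c0; have c20 : 0 < 2 * c by rewrite mulr_gt0.
have dge1 b : 0 < b -> 1 <= theta_ratio (2 * b) 0.
  move=> b0; have := alt_ratioM 0 0 b0; rewrite addr0 subrr -expr2 => h.
  have b20 : 0 < 2 * b by rewrite mulr_gt0.
  have := theta_ratio_gt0 0 b20; move: (theta_ratio _ _) h => d h d0.
  have : 0 <= (d ^+ 2 - 1) / (d ^+ 2 + 1) by rewrite -h -expr2 sqr_ge0.
  by rewrite pmulr_lge0 ?invr_gt0; nra.
split.
  rewrite /rho alt_ratioE// mul0r; have := dge1 (2 * c) c20.
  rewrite (_ : 2 * (2 * c) = 4 * c); last by ring.
  move=> h; rewrite divr_ge0//; lra.
have h := alt_ratioM 0 0 c0; rewrite addr0 subrr -expr2 -/(rho c) in h.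
rewrite expr_div_n (expr2 (rho c)) h /rho alt_ratioE ?divr_gt0// mul0r (_ : 4 * (c / 2) = 2 * c); last by field.
have := dge1 c c0; move: (theta_ratio _ _) => d d1.
rewrite -subr_ge0 (_ : _ - _ = (d - 1) ^+ 3 / (4 * (d ^+ 2 + 1) * (d + 1))); last first.
  by field; rewrite !gt_eqF//; nra.
by rewrite divr_ge0 ?exprn_ge0 ?mulr_ge0//; nra.
Qed.

(** Partial products of [rho c], which decrease to it. *)
Definition tanhprod (I : nat) c : R := \prod_(i < I) tanh (c * (i%:R + 2^-1)) ^+ 2.

Lemma tanhprod_noninc c : 0 < c -> nonincreasing_seq (tanhprod ^~ c).
Proof.
move=> c0; apply/nonincreasing_seqP => I; rewrite /tanhprod big_ord_recr /=.
apply: ler_piMr; first by apply: prodr_ge0 => i _; rewrite sqr_ge0.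
by rewrite -real_normK ?num_real// exprn_ile1// normr_tanh_le1.
Qed.

Lemma rho_le_tanhprod c I : 0 < c -> rho c <= tanhprod I c.
Proof.
move=> c0; have h := alt_ratio_lim (z := 0) c0.
rewrite (_ : (fun M => _) = tanhprod ^~ c) in h; last first.
  by apply/funext => M; apply: eq_bigr => m _; rewrite subr0 addr0 expr2.
have := nonincreasing_cvgn_ge (tanhprod_noninc c0) (cvgP _ h) I.
by rewrite (cvg_lim _ h).
Qed.

End Quotient.

(** * Odd reciprocal squares and the artanh series *)

Section Basel.
Variable R : realType.
Implicit Types c x y z u v t : R.

Lemma is_derive_ge0_le (f f' : R -> R) (b : R) : 0 <= b ->
  (forall x, 0 <= x <= b -> is_derive x 1 f (f' x)) ->
  (forall x, 0 <= x <= b -> 0 <= f' x) -> f 0 <= f b.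
Proof.
move=> b0 df f'0.
apply: (@ger0_derive1_ndecr R f 0 b) => //.
- by move=> x; rewrite in_itv/= => /andP[/ltW x0 /ltW xb]; apply: ex_derive; apply: df; rewrite x0.
- move=> x; rewrite in_itv/= => /andP[/ltW x0 /ltW xb]; rewrite derive1E.
  by have := df x; rewrite x0 xb => /(_ isT) h; rewrite derive_val f'0// x0.
- apply: continuous_in_subspaceT => x; rewrite inE /= in_itv/= => /df h.
  by apply: differentiable_continuous; apply/derivable1_diffP; apply: ex_derive.
Qed.

(** The derivative of [sin x - x * cos x] is [x * sin x]. *)
Lemma mulr_cos_le_sin x : 0 <= x <= pi -> x * cos x <= sin x.
Proof.
move=> /andP[x0 xpi]; rewrite -subr_ge0.
have := @is_derive_ge0_le (fun y => sin y - y * cos y) (fun y => y * sin y) x x0.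
rewrite sin0 mul0r subr0; apply => y /andP[y0 yx].
  apply: is_derive_eq; rewrite /GRing.scale /=; ring.
by rewrite mulr_ge0// sin_ge0_pi// y0 (le_trans yx).
Qed.

(** Taylor polynomial of the inverse hyperbolic tangent. *)
Definition oddpow (J : nat) t : R := \sum_(j < J) t ^+ (2 * j).+1 / (2 * j).+1%:R.

Lemma is_derive_oddpow J t : is_derive t 1 (oddpow J) (\sum_(j < J) t ^+ (2 * j)).
Proof.
pose p : {poly R} := \sum_(j < J) (2 * j).+1%:R^-1 *: 'X^((2 * j).+1).
have -> : oddpow J = horner p.
  apply/funext => x; rewrite /oddpow horner_sum; apply: eq_bigr => j _.
  by rewrite hornerZ hornerXn mulrC.
have -> : \sum_(j < J) t ^+ (2 * j) = p^`().[t]; last exact: is_derive_poly.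
rewrite linear_sum horner_sum; apply: eq_bigr => j _.
rewrite linearZ /= derivXn hornerZ hornerMn hornerXn  mulrnAr -mulr_natl mulVKf//.
Qed.

Lemma oddpow_le_artanh J t : 0 <= t < 1 -> 2 * oddpow J t <= ln (1 + t) - ln (1 - t).
Proof.
move=> /andP[t0 t1]; rewrite -subr_ge0.
have := @is_derive_ge0_le (fun y => ln (1 + y) - ln (1 - y) - 2 * oddpow J y)
  (fun y => (1 + y)^-1 + (1 - y)^-1 - 2 * \sum_(j < J) y ^+ (2 * j)) t t0.
have -> : ln (1 + 0) - ln (1 - 0) - 2 * oddpow J 0 = 0 :> R.
  rewrite addr0 subr0 subrr /oddpow big1 ?mulr0 ?subr0// => j _.
  by rewrite expr0n mul0r.
apply => y /andP[y0 yt].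
  have y1 : 0 < 1 - y by lra.
  have d1 : is_derive y 1 (fun y => ln (1 + y)) (1 + y)^-1.
    have h : is_derive y 1 (fun y : R => 1 + y) 1.
      by have := is_deriveD (is_derive_cst (1 : R) y 1) (is_derive_id y 1); rewrite add0r; apply.
    have h2 : is_derive (1 + y) 1 (@ln R) (1 + y)^-1 by apply: is_derive1_ln; lra.
    by have := @is_derive1_comp R (@ln R) (fun y => 1 + y) y _ _ h2 h; rewrite mulr1; apply.
  have d2 : is_derive y 1 (fun y => ln (1 - y)) (- (1 - y)^-1).
    have h : is_derive y 1 (fun y : R => 1 - y) (- 1).
      by have := is_deriveB (is_derive_cst (1 : R) y 1) (is_derive_id y 1); rewrite sub0r; apply.
    have h2 : is_derive (1 - y) 1 (@ln R) (1 - y)^-1 by apply: is_derive1_ln; lra.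
    by have := @is_derive1_comp R (@ln R) (fun y => 1 - y) y _ _ h2 h; rewrite mulrN1; apply.
  have d3 := is_derive_oddpow J y.
  have d12 := is_deriveB d1 d2; rewrite opprK in d12.
  by have := is_deriveB d12 (is_deriveZ 2 d3); apply.
have y2 : 0 < 1 - y ^+ 2 by nra.
have -> : (1 + y)^-1 + (1 - y)^-1 = 2 / (1 - y ^+ 2).
  by field; rewrite !gt_eqF//; nra.
rewrite subr_ge0 ler_pM2l// -[X in _ <= X]div1r ler_pdivlMr//.
have -> : (\sum_(j < J) y ^+ (2 * j)) * (1 - y ^+ 2) = 1 - y ^+ (2 * J).
  elim: J => [|J IH]; first by rewrite big_ord0 mul0r expr0 subrr.
  rewrite big_ord_recr /= mulrDl IH mulnS exprD; ring.
by rewrite gerBl exprn_ge0.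
Qed.

Definition oddbasel J : R := \sum_(j < J) ((2 * j).+1%:R ^+ 2)^-1.

Lemma sin_grid_gt0 n j : (j < n)%N -> 0 < sin ((2 * j).+1%:R * (pi / (4 * n%:R))) :> R.
Proof.
move=> jn; have n0 : 0 < n%:R :> R by rewrite ltr0n; lia.
have pi0 := pi_gt0 R; apply: sin_gt0_pi; apply/andP; split.
  by rewrite mulr_gt0 ?divr_gt0 ?mulr_gt0.
rewrite mulrA ltr_pdivrMr ?mulr_gt0// mulrC ltr_pM2l//.
by rewrite -natrM ltr_nat; lia.
Qed.

Lemma cos_grid_gt0 n j : (j < n)%N -> 0 < cos ((2 * j).+1%:R * (pi / (4 * n%:R))) :> R.
Proof.
move=> jn; have n0 : 0 < n%:R :> R by rewrite ltr0n; lia.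
have pi0 := pi_gt0 R; apply: cos_gt0_pihalf; apply/andP; split.
  apply: lt_trans (_ : 0 < _); first by rewrite oppr_lt0 divr_gt0.
  by rewrite mulr_gt0 ?divr_gt0 ?mulr_gt0.
rewrite mulrA ltr_pdivrMr ?mulr_gt0// (_ : pi / 2 * (4 * n%:R) = pi * (2 * n%:R)); last by field.
by rewrite mulrC ltr_pM2l// -natrM ltr_nat; lia.
Qed.

(** Doubling: [1 / sin^2 + 1 / cos^2] at [x] is [4 / sin^2] at [2 x]. *)
Lemma sum_inv_sin_sqr r (n := (2 ^ r)%N) :
  \sum_(j < n) (sin ((2 * j).+1%:R * (pi / (4 * n%:R))) ^+ 2)^-1 = 2 * n%:R ^+ 2 :> R.
Proof.
rewrite /n {n}; elim: r => [|r IH]; [pose n := (2 ^ 0)%N|pose n := (2 ^ r.+1)%N]; rewrite -/n.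
  rewrite /n expn0 big_ord_recl big_ord0 mul1r addr0 mulr1 expr1n mulr1.
  have h : cos (pi / 4 *+ 2) = 0 :> R.
    by rewrite -mulr_natl (_ : _ * _ = pi / 2) ?cos_pihalf//; field.
  rewrite cos_mulr2n in h.
  have -> : sin (pi / 4) ^+ 2 = 2^-1 :> R by have := cos2Dsin2 (pi / 4 : R); lra.
  by rewrite invrK.
set k := (2 ^ r)%N in IH; have nE : n = (2 * k)%N by rewrite /n expnS.
have k0 : 0 < k%:R :> R by rewrite ltr0n expn_gt0.
pose f j : R := (sin ((2 * j).+1%:R * (pi / (4 * n%:R))) ^+ 2)^-1.
rewrite -(big_mkord xpredT f) (big_cat_nat (n := k)) ?nE//=; last by lia.
rewrite [X in _ + X](_ : _ = \sum_(0 <= j < k) f (2 * k - j.+1)%N); last first.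
  rewrite -{1}[k]add0n big_addn (_ : (2 * k - k = k)%N); last by lia.
  rewrite big_nat_rev /=; apply: eq_big_nat => j /andP[_ jk]; congr f; lia.
rewrite -big_split /= big_mkord.
rewrite (eq_bigr (fun j : 'I_k => 4 * (sin ((2 * j).+1%:R * (pi / (4 * k%:R))) ^+ 2)^-1)).
  rewrite -mulr_sumr IH natrM; ring.
move=> j _; rewrite /f nE.
set al := (2 * j).+1%:R * (pi / (4 * (2 * k)%:R)).
have -> : (2 * (2 * k - j.+1)).+1%:R * (pi / (4 * (2 * k)%:R)) = pi / 2 - al :> R.
  have -> : (2 * (2 * k - j.+1)).+1 = (4 * k - (2 * j).+1)%N by have := ltn_ord j; lia.
  rewrite natrB; last by have := ltn_ord j; lia.
  by rewrite /al !natrM; field; rewrite gt_eqF.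
have -> : (2 * j).+1%:R * (pi / (4 * k%:R)) = al *+ 2 :> R.
  by rewrite /al -mulr_natl natrM; field; rewrite gt_eqF.
have s0 : 0 < sin al by apply: sin_grid_gt0; have := ltn_ord j; lia.
have c0 : 0 < cos al by apply: cos_grid_gt0; have := ltn_ord j; lia.
rewrite sinB sin_pihalf cos_pihalf mul1r mul0r subr0 sin_mulr2n.
rewrite -[4](_ : 2 ^+ 2 = _ :> R); last by ring.
rewrite -mulr_natl; have := cos2Dsin2 al; move: (sin al) (cos al) s0 c0 => s c s0 c0 h.
transitivity ((c ^+ 2 + s ^+ 2) / (c ^+ 2 * s ^+ 2)); first by field; rewrite !gt_eqF.
by rewrite h; field; rewrite !gt_eqF.
Qed.

(** The lower half of Euler's [pi^2 / 8], from [1 / sin^2 x <= 1 + 1 / x^2] in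
    [sum_inv_sin_sqr]. *)
Lemma oddbasel_ge r (n := (2 ^ r)%N) :
  pi ^+ 2 / 8 - pi ^+ 2 / (16 * n%:R) <= oddbasel n.
Proof.
have n0 : 0 < n%:R :> R by rewrite ltr0n expn_gt0.
have pi0 := pi_gt0 R.
have h : 2 * n%:R ^+ 2 <= n%:R + 16 * n%:R ^+ 2 / pi ^+ 2 * oddbasel n.
  rewrite -sum_inv_sin_sqr -/n mulr_sumr.
  rewrite -[X in _ <= X + _](_ : \sum_(j < n) 1 = _); last by rewrite sumr_const card_ord.
  rewrite -big_split /=; apply: ler_sum => j _.
  set x := _ * (pi / _); have s0 : 0 < sin x := sin_grid_gt0 (ltn_ord j).
  have c0 : 0 < cos x := cos_grid_gt0 (ltn_ord j).
  have x0 : 0 < x by rewrite /x mulr_gt0 ?divr_gt0 ?mulr_gt0.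
  have -> : 16 * n%:R ^+ 2 / pi ^+ 2 * ((2 * j).+1%:R ^+ 2)^-1 = (x ^+ 2)^-1.
    have gen (a p k : R) : 0 < a -> 0 < p -> 0 < k ->
        16 * k ^+ 2 / p ^+ 2 * (a ^+ 2)^-1 = ((a * (p / (4 * k))) ^+ 2)^-1.
      by move=> *; field; rewrite !gt_eqF.
    by apply: gen.
  have xpi : x <= pi.
    rewrite /x mulrA ler_pdivrMr ?mulr_gt0// mulrC ler_pM2l// -natrM ler_nat.
    by have := ltn_ord j; lia.
  have := @mulr_cos_le_sin x; rewrite ltW//= => /(_ xpi) h.
  have : (x * cos x) ^+ 2 <= sin x ^+ 2 by rewrite ler_pXn2r// nnegrE ltW// mulr_gt0.
  rewrite exprMn cos2sin2 => h2.
  rewrite -subr_ge0 (_ : _ - _ = (sin x ^+ 2 - x ^+ 2 * (1 - sin x ^+ 2)) / (x ^+ 2 * sin x ^+ 2)).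
    by rewrite divr_ge0 ?subr_ge0// mulr_ge0 ?sqr_ge0.
  by field; rewrite !gt_eqF.
have p20 : 0 < pi ^+ 2 :> R by rewrite exprn_gt0.
move: (pi ^+ 2) (n%:R) p20 n0 h => p k p0 k0 h.
rewrite (_ : p / 8 - _ = (2 * k ^+ 2 - k) * (p / (16 * k ^+ 2))); last by field; rewrite gt_eqF.
rewrite [X in _ <= X](_ : _ = (16 * k ^+ 2 / p * oddbasel n) * (p / (16 * k ^+ 2))).
  apply: ler_wpM2r; last by lra.
  by apply/ltW; rewrite divr_gt0// mulr_gt0// exprn_gt0.
by field; rewrite !gt_eqF.
Qed.

(** [tanh x = (1 - t) / (1 + t)] with [t = exp (- 2 x)]. *)
Lemma tanh_le_expR J x : 0 < x -> tanh x <= expR (- (2 * oddpow J (expR (- (2 * x))))).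
Proof.
move=> x0; rewrite /tanh; set t := expR _; have t0 : 0 < t := expR_gt0 _.
have t1 : t < 1 by rewrite expR_lt1; lra.
have h := @oddpow_le_artanh J t; rewrite ltW//= in h; move/(_ t1) in h.
apply: le_trans (_ : expR (- (ln (1 + t) - ln (1 - t))) <= _); last by rewrite ler_expR lerN2.
by rewrite opprB expRB !lnK// posrE; lra.
Qed.

End Basel.

(** * The bound on rho *)

Section Rho.
Variable R : realType.
Implicit Types c x y z u v t : R.

(** A geometric series whose ratio [y] satisfies [1 - y <= 2 c m]. *)
Lemma sum_expR_ge I J m c : 0 < c -> (0 < m <= 2 * J)%N ->
  expR (- (2 * J%:R * c)) * (1 - expR (- (2 * c * I%:R))) / (2 * c * m%:R) <=
  \sum_(i < I) expR (- (c * (2 * i).+1%:R)) ^+ m.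
Proof.
move=> c0 /andP[m0 mJ]; have m0' : 0 < m%:R :> R by rewrite ltr0n.
set y := expR (- (2 * c * m%:R)).
have yI : y ^+ I <= expR (- (2 * c * I%:R)).
  rewrite -expRM_natl ler_expR mulrN lerN2.
  have : 1 <= m%:R :> R by rewrite ler1n.
  have : 0 <= c * I%:R by rewrite mulr_ge0 ?(ltW c0).
  nra.
have -> : \sum_(i < I) expR (- (c * (2 * i).+1%:R)) ^+ m = expR (- (c * m%:R)) * \sum_(i < I) y ^+ i.
  rewrite mulr_sumr; apply: eq_bigr => i _; rewrite -!expRM_natl -expRD.
  by congr expR; rewrite -natr1 natrM; ring.
have y0 : 0 < y := expR_gt0 _.
have geo : (1 - y) * (\sum_(i < I) y ^+ i) = 1 - y ^+ I.
  elim: (I) => [|n IH]; first by rewrite big_ord0 mulr0 subrr.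
  rewrite big_ord_recr mulrDr IH exprS /=; ring.
have y1 : 1 - y <= 2 * c * m%:R by have := expR_ge1Dx (- (2 * c * m%:R)); rewrite -/y; lra.
have S0 : 0 <= \sum_(i < I) y ^+ i by apply: sumr_ge0 => i _; rewrite exprn_ge0// ltW.
rewrite ler_pdivrMr ?mulr_gt0// -[leRHS]mulrA; apply: ler_pM; rewrite ?expR_ge0//.
- by rewrite subr_ge0 expR_le1 oppr_le0 !mulr_ge0// ltW.
- rewrite ler_expR lerN2 [leLHS]mulrC ler_pM2r//.
  by rewrite -natrM ler_nat.
by rewrite [leRHS]mulrC; apply: le_trans (ler_wpM2r S0 y1); rewrite geo; lra.
Qed.

(** Take logarithms, expand them by [tanh_le_expR] and sum over the lattice first:
    the contribution of degree [m] is close to [1 / (2 c m)], which together with the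
    coefficient [1 / m] gives the reciprocal squares. *)
Lemma tanhprod_le I J c : 0 < c ->
  tanhprod I c <= expR (- (2 / c * oddbasel R J *
    (expR (- (2 * J%:R * c)) * (1 - expR (- (2 * c * I%:R)))))).
Proof.
move=> c0.
apply: le_trans (_ : \prod_(i < I) expR (- (4 * oddpow J (expR (- (c * (2 * i).+1%:R))))) <= _).
  apply: ler_prod => i _; rewrite sqr_ge0 /=.
  have x0 : 0 < c * (i%:R + 2^-1) by rewrite mulr_gt0// ltr_pwDr// invr_gt0.
  have := tanh_le_expR J x0.
  rewrite (_ : 2 * (c * (i%:R + 2^-1)) = c * (2 * i).+1%:R); last first.
    by rewrite -[(2 * i).+1%:R](natr1 (2 * i)) natrM; field.
  set o := oddpow J _ => h.
  have -> : expR (- (4 * o)) = expR (- (2 * o)) ^+ 2.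
    by rewrite -expRM_natl; congr expR; ring.
  by rewrite ler_pXn2r// nnegrE ?expR_ge0// tanh_ge0// ltW.
rewrite -expR_sum ler_expR sumrN lerN2.
set E := expR _ * _.
under eq_bigr do rewrite /oddpow mulr_sumr.
rewrite exchange_big /= /oddbasel mulr_sumr mulr_suml; apply: ler_sum => j _.
have jm : (0 < (2 * j).+1 <= 2 * J)%N by have := ltn_ord j; lia.
have := sum_expR_ge I c0 jm; rewrite -/E => h.
rewrite -mulr_sumr -mulr_suml.
have m0 : 0 < (2 * j).+1%:R :> R by rewrite ltr0n.
move: ((2 * j).+1%:R) m0 h => m m0 h.
rewrite [leLHS](_ : _ = 4 * (E / (2 * c * m) / m)); last by field; rewrite !gt_eqF.
by rewrite ler_pM2l// ler_pM2r ?invr_gt0.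
Qed.

Lemma rho_pow_le c m : 0 < c -> (rho c / 2) ^+ (2 ^ m) <= rho (c / 2 ^+ m) / 2.
Proof.
move=> c0; elim: m => [|m IH]; first by rewrite expn0 expr0 divr1 expr1.
have cm0 : 0 < c / 2 ^+ m by rewrite divr_gt0// exprn_gt0.
rewrite expnSr exprM.
have [r0 _] := rho_sqr_le c0.
have [_ h] := rho_sqr_le cm0.
rewrite [X in c / X]exprSr invfM mulrA; apply: le_trans h.
apply: lerXn2r => //; rewrite nnegrE; first exact/exprn_ge0/divr_ge0.
by rewrite divr_ge0//; case: (rho_sqr_le cm0).
Qed.

(** Halve [c] [2 N] times before applying [tanhprod_le]; its errors then come from
    [c / 2 ^ N] and [c * 2 ^ N]. *)
Lemma rho_le N c : 0 < c ->
  rho c / 2 <= expR (- (2 / c * oddbasel R (2 ^ N) *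
    (expR (- (2 * c / 2 ^+ N)) * (1 - expR (- (2 * c * 2 ^+ N)))))).
Proof.
move=> c0; set m := (2 * N)%N; set J := (2 ^ N)%N.
have m0 : 0 < 2 ^+ m :> R by rewrite exprn_gt0.
have N0 : 0 < 2 ^+ N :> R by rewrite exprn_gt0.
have cm0 : 0 < c / 2 ^+ m by rewrite divr_gt0.
have h := le_trans (rho_pow_le m c0) (_ : _ <= tanhprod (2 ^ (m + N)) (c / 2 ^+ m)).
have {h} h1 : (rho c / 2) ^+ (2 ^ m) <= tanhprod (2 ^ (m + N)) (c / 2 ^+ m).
  apply: h; have := rho_le_tanhprod (2 ^ (m + N)) cm0; have [] := rho_sqr_le cm0; lra.
have h2 := le_trans h1 (tanhprod_le (2 ^ (m + N)) J cm0).
have [r0 _] := rho_sqr_le c0.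
have r20 : 0 <= rho c / 2 by rewrite ler_pdivlMr// mul0r.
rewrite -(@ler_pXn2r _ (2 ^ m)) ?expn_gt0// ?nnegrE ?expR_ge0//.
apply: le_trans h2 _; rewrite -expRM_natl ler_expR le_eqVlt; apply/orP; left; apply/eqP.
rewrite /J !natrX exprD.
have mE : 2 ^+ m = 2 ^+ N ^+ 2 :> R by rewrite -exprM mulnC.
have -> : 2 * 2 ^+ N * (c / 2 ^+ m) = 2 * c / 2 ^+ N by rewrite mE; field; rewrite gt_eqF.
have -> : 2 * (c / 2 ^+ m) * (2 ^+ m * 2 ^+ N) = 2 * c * 2 ^+ N by field; rewrite gt_eqF.
rewrite invf_div; set E := expR _ * _; set b := oddbasel _ _.
move: (2 ^+ m) E b => p E b.
by field; rewrite gt_eqF.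
Qed.

Lemma rho_le_expR c : 0 < c -> rho c <= 2 * expR (- (pi ^+ 2 / (4 * c))).
Proof.
move=> c0; have pi0 : 0 < pi ^+ 2 :> R by rewrite exprn_gt0// pi_gt0.
suff : rho c / 2 <= expR (- (pi ^+ 2 / (4 * c))) by lra.
have cx : (2^-1 : R) ^+ n @[n --> \oo] --> 0.
  by apply: cvg_expr; rewrite ger0_norm ?invr_ge0//; lra.
(* with x = 1 / 2 ^ N, a lower bound for the exponent in rho_le *)
pose g x := - (2 / c * (pi ^+ 2 / 8 - pi ^+ 2 / 16 * x) * ((1 - 2 * c * x) * (1 - x / (2 * c)))).
have gg : g (2^-1 ^+ n) @[n --> \oo] --> g 0.
  apply: cvgN; apply: cvgM; [apply: cvgM; [exact: cvg_cst|]|apply: cvgM];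
    apply: cvgB; try exact: cvg_cst; apply: cvgM => //; exact: cvg_cst.
have cg : expR (g (2^-1 ^+ n)) @[n --> \oo] --> expR (g 0).
  exact: (cvg_comp _ _ gg (@continuous_expR R _)).
have <- : g 0 = - (pi ^+ 2 / (4 * c)).
  by rewrite /g; move: (pi ^+ 2) => p; field; rewrite gt_eqF.
rewrite -(cvg_lim _ cg)//; apply: limr_ge; first by apply/cvg_ex; exists (expR (g 0)).
have c2 : 0 < (2 * c)^-1 by rewrite invr_gt0 mulr_gt0.
have : \forall n \near \oo, 2^-1 ^+ n <= (2 * c)^-1 /\ 2^-1 ^+ n <= 2 * c :> R.
  move/cvgrPdist_le : cx => cx.
  have e0 : 0 < Num.min (2 * c)^-1 (2 * c) by rewrite lt_min c2 mulr_gt0.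
  apply: filterS (cx _ e0) => n; rewrite sub0r normrN ger0_norm ?exprn_ge0 ?invr_ge0//.
  by rewrite le_min => /andP[].
apply: filterS => N [h1 h2].
apply: le_trans (rho_le N c0) _; rewrite ler_expR lerN2.
have x0 : 0 < 2^-1 ^+ N :> R by rewrite exprn_gt0.
have xE : 2 ^+ N = (2^-1 ^+ N)^-1 :> R by rewrite exprVn invrK.
have b : pi ^+ 2 / 8 - pi ^+ 2 / (16 * (2 ^ N)%:R) <= oddbasel R (2 ^ N) := oddbasel_ge R N.
rewrite natrX in b.
rewrite xE; rewrite xE in b; have x1 : 2^-1 ^+ N <= 1 :> R by rewrite exprn_ile1 ?invr_ge0 ?invf_le1 ?ler1n.
move: (2^-1 ^+ N) x0 x1 h1 h2 b {xE} => x x0 x1 h1 h2 b.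
rewrite invrK; rewrite (_ : pi ^+ 2 / (16 * x^-1) = pi ^+ 2 / 16 * x) in b; last first.
  by move: (pi ^+ 2) => p; field; rewrite gt_eqF.
have e1 : 1 - 2 * c * x <= expR (- (2 * c * x)) by have := expR_ge1Dx (- (2 * c * x)); lra.
have e2 : 1 - x / (2 * c) <= 1 - expR (- (2 * c / x)).
  rewrite lerD2l lerN2 expRN -[leRHS]invf_div lef_pV2 ?posrE ?expR_gt0 ?divr_gt0 ?mulr_gt0//.
  by have := expR_ge1Dx (2 * c / x); lra.
have f1 : 0 <= 1 - 2 * c * x by rewrite subr_ge0 mulrC -ler_pdivlMr ?mulr_gt0// div1r.
have f2 : 0 <= 1 - x / (2 * c) by rewrite subr_ge0 ler_pdivrMr ?mulr_gt0// mul1r.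
apply: ler_pM.
- apply: mulr_ge0; first by rewrite divr_ge0// ltW.
  by rewrite subr_ge0; move: (pi ^+ 2) pi0 => p p0; nra.
- exact: mulr_ge0.
- by apply: ler_wpM2l => //; rewrite divr_ge0// ltW.
- exact: ler_pM.
Qed.

End Rho.

(** * Zolotarev's problem on a symmetric pair of intervals *)

Section Collapse.
Variable R : realType.
Implicit Types c x y z u v : R.

(** The interval [- M <= t < M] is symmetric under [t |-> - t - 1]. *)
Lemma prod_int_fold (h : int -> R) M :
  \prod_(m < M) (h m%:Z * h (- m%:Z - 1)) = \prod_(t < 2 * M) h (t%:Z - M%:Z).
Proof.
rewrite big_split /= -(big_mkord xpredT (fun t => h (t%:Z - M%:Z))).
rewrite (big_cat_nat (n := M))//=; last by lia.
rewrite mulrC; congr (_ * _).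
  rewrite big_nat_rev /= big_mkord; apply: eq_bigr => m _; congr h; have := ltn_ord m; lia.
rewrite [RHS](_ : _ = \prod_(0 <= i < M) h ((i + M)%N%:Z - M%:Z)).
  by rewrite big_mkord; apply: eq_bigr => m _; congr h; lia.
by rewrite -{1}[M]add0n big_addn (_ : (2 * M - M = M)%N)//; lia.
Qed.

Lemma prod_nat_blocks (h : nat -> R) n T :
  \prod_(t < T) \prod_(i < n) h (n * t + i)%N = \prod_(t < n * T) h t.
Proof.
elim: T => [|T IH]; first by rewrite muln0 !big_ord0.
rewrite big_ord_recr /= IH -!(big_mkord xpredT) mulnS [(n + _)%N]addnC.
rewrite [RHS](big_cat_nat (n := (n * T)%N))//=; last by lia.
congr (_ * _); rewrite [RHS](_ : _ = \prod_(0 <= i < n) h (i + n * T)%N).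
  by rewrite ?big_mkord; apply: eq_bigr => i _; rewrite addnC.
by rewrite -{1}[(n * T)%N]add0n big_addn addKn.
Qed.

(** Each factor on the left is a limit of products of [|tanh|] over the lattice of
    step [c], shifted by a multiple of [c / n]; together these lattices fill the
    lattice of step [c / n]. All factors are at most 1, so it suffices to keep
    the [2 J] points that are closest to 0, and [tanhM_le] centers them. *)
Lemma alt_ratio_collapse n c u J : (0 < n)%N -> 0 < c ->
  `|\prod_(i < n) alt_ratio c (u + ((2 * i).+1%:R - n%:R) / (2 * n%:R))| <= tanhprod J (c / n%:R).
Proof.
move=> n0 c0; have n0' : 0 < n%:R :> R by rewrite ltr0n.
set c' := c / n%:R; have c'0 : 0 < c' by rewrite divr_gt0.
pose w (i : nat) : R := u + ((2 * i).+1%:R - n%:R) / (2 * n%:R).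
pose P M := \prod_(i < n) \prod_(m < M)
  (tanh (c * (m%:R + 2^-1 - w i)) * tanh (c * (m%:R + 2^-1 + w i))).
have cP : P M @[M --> \oo] --> \prod_(i < n) alt_ratio c (w i).
  by apply: cvg_big => [|i _]; [exact: mul_continuous|exact: alt_ratio_lim].
have cP' : `|P M| @[M --> \oo] --> `|\prod_(i < n) alt_ratio c (w i)| by exact: cvg_norm.
rewrite -(cvg_lim _ cP')//; apply: limr_le; first by apply/cvg_ex; eexists; exact: cP'.
(* the lattice point nearest to the center of the window *)
pose s : int := Num.floor (n%:R * u + 2^-1).
pose F (t : int) : R := `|tanh (c' * (t%:~R + 2^-1 - n%:R * u))|.
have F0 t : 0 <= F t by exact: normr_ge0.
have F1 t : F t <= 1 by exact: normr_tanh_le1.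
have PE M : `|P M| = \prod_(t < n * (2 * M)) F (t%:Z - (n * M)%:Z).
  rewrite -(prod_nat_blocks (fun t => F (t%:Z - (n * M)%:Z))) exchange_big /=.
  rewrite /P normr_prod [RHS](reindex_inj rev_ord_inj) /=; apply: eq_bigr => i _.
  rewrite normr_prod.
  transitivity (\prod_(t < 2 * M) `|tanh (c * ((t%:Z - M%:Z)%:~R + 2^-1 - w i))|).
    rewrite -(prod_int_fold (fun t => `|tanh (c * (t%:~R + 2^-1 - w i))|)).
    apply: eq_bigr => m _; rewrite normrM; congr (_ * _).
    rewrite -normrN -tanhN; congr (`|tanh _|); rewrite rmorphB rmorphN /=.
    by field.
  apply: eq_bigr => t _; rewrite /F; congr (`|tanh _|).
  have -> : ((n * t + (n - i.+1))%N%:Z - (n * M)%:Z) = n%:Z * t%:Z + n%:Z - i%:Z - 1 - n%:Z * M%:Z :> int.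
    by have := ltn_ord i; lia.
  rewrite /c' /w -[(2 * i).+1%:R](natr1 (2 * i)) natrM !rmorphB !rmorphD !rmorphM /=.
  by field; rewrite gt_eqF.
exists (J + `|s|)%N => // M /= MJ.
have nM : (M <= n * M)%N by rewrite leq_pmull.
rewrite PE.
have t0E : exists t0 : nat, t0%:Z = (n * M)%:Z + s - J%:Z.
  by exists (absz ((n * M)%:Z + s - J%:Z)%R); lia.
case: t0E => t0 t0E.
have prod01 a b (G : nat -> R) : (forall t, 0 <= G t <= 1) -> 0 <= \prod_(a <= t < b) G t <= 1.
  move=> G01; apply: (big_ind (fun x : R => 0 <= x <= 1)) => [|x y /andP[x0 x1] /andP[y0 y1]|t _ //].
    by rewrite ler01 lexx.
  by rewrite mulr_ge0// mulr_ile1.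
rewrite -(big_mkord xpredT (fun t => F (t%:Z - (n * M)%:Z))).
rewrite (big_cat_nat (n := t0))//=; last by lia.
rewrite (big_cat_nat (m := t0) (n := (t0 + 2 * J)%N))//=; try by lia.
have G01 t : 0 <= F (t%:Z - (n * M)%:Z) <= 1 by rewrite F0 F1.
have /andP[A0 A1] := prod01 0 t0 _ G01.
have /andP[B0 B1] := prod01 t0 (t0 + 2 * J)%N _ G01.
have /andP[C0 C1] := prod01 (t0 + 2 * J)%N (n * (2 * M))%N _ G01.
apply: le_trans (_ : \prod_(t0 <= t < t0 + 2 * J) F (t%:Z - (n * M)%:Z) <= _).
  by rewrite -[leRHS]mul1r ler_pM ?mulr_ge0// ler_piMr.
rewrite [leLHS](_ : _ = \prod_(0 <= t < 2 * J) F ((t + t0)%N%:Z - (n * M)%:Z)); last first.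
  by rewrite -{1}[t0]add0n big_addn addKn.
rewrite big_mkord.
rewrite (eq_bigr (fun t : 'I_(2 * J) => F (s + (t%:Z - J%:Z)))); last first.
  by move=> t _; congr F; lia.
rewrite -(prod_int_fold (fun t => F (s + t))) /tanhprod.
apply: ler_prod => i _; rewrite mulr_ge0//=.
pose y := n%:R * u - s%:~R.
have hy : `|y| <= 2^-1.
  have /andP[] := floor_itv (n%:R * u + 2^-1); rewrite -/s rmorphD /= => h1 h2.
  rewrite ler_norml /y; lra.
rewrite -normrM.
have -> : c' * ((s + i%:Z)%:~R + 2^-1 - n%:R * u) = c' * (i%:R + 2^-1) - c' * y.
  by rewrite /y rmorphD /=; ring.
have -> : c' * ((s + (- i%:Z - 1))%:~R + 2^-1 - n%:R * u) = - (c' * (i%:R + 2^-1) + c' * y).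
  by rewrite /y rmorphD rmorphB rmorphN /=; field.
rewrite tanhN mulrN normrN; apply: tanhM_le.
rewrite normrM (gtr0_norm c'0) ler_pM2l//.
by apply: le_trans hy _; rewrite lerDr.
Qed.

End Collapse.

Section Zolotarev.
Variable R : realType.
Implicit Types c x y z u v : R.

(** For [n >= 0], both half-integers [n + 1/2] and [- n - 1/2] satisfy
    [(n + 1/2)^2 >= n^2 + 1/4]. *)
Lemma theta_ratio0_ge c : 0 < c -> expR (c / 4) / 2 <= theta_ratio c 0.
Proof.
move=> c0; rewrite /theta_ratio ler_pdivlMr ?theta_gt0// sub0r.
have h0 := theta_esum 0 c0; have h1 := theta_esum (- 2^-1) c0.
rewrite !esum_int in h0 h1; try exact: gauss_ge0.
have half (s : nat -> int) : (forall n, n%:R ^+ 2 + 4^-1 <= (- 2^-1 - (s n)%:~R) ^+ 2 :> R) ->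
    (\sum_(n <oo) (gauss c (- 2^-1) (s n))%:E <= (expR (- (c / 4)) * theta c 0)%:E)%E.
  move=> hs; rewrite EFinM -h0.
  apply: le_trans (_ : (expR (- (c / 4)))%:E * (\sum_(n <oo) (gauss c 0 (Posz n))%:E) <= _)%E.
    rewrite -nneseriesZl; last by move=> n _; rewrite lee_fin gauss_ge0.
    apply: lee_nneseries => [n _ _|n _]; first by rewrite lee_fin gauss_ge0.
    rewrite -EFinM lee_fin /gauss -expRD ler_expR sub0r sqrrN -[leRHS]opprD lerN2.
    rewrite (_ : c / 4 + _ = c * (n%:R ^+ 2 + 4^-1)); last by rewrite pmulrn; ring.
    by rewrite ler_pM2l.
  apply: lee_wpmul2l; first by rewrite lee_fin expR_ge0.
  by apply: leeDl; apply: nneseries_ge0 => n _ _; rewrite lee_fin gauss_ge0.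
have p1 := half Posz _; have p2 := half Negz _.
have : ((theta c (- 2^-1))%:E <= (expR (- (c / 4)) * theta c 0 + expR (- (c / 4)) * theta c 0)%:E)%E.
  rewrite -h1 EFinD; apply: leeD; [apply: p1|apply: p2] => n.
    rewrite -[(Posz n)%:~R]/(n%:R : R); have : 0 <= (n%:R : R) by [].
    by move: (n%:R : R) => y y0; rewrite -subr_ge0 (_ : _ - _ = y)//; field.
  rewrite NegzE rmorphN /= -[(Posz n.+1)%:~R]/(n.+1%:R : R) -[n.+1%:R](natr1 n); have : 0 <= (n%:R : R) by [].
  by move: (n%:R : R) => y y0; rewrite -subr_ge0 (_ : _ - _ = y)//; field.
rewrite lee_fin expRN => h.
have e0 := expR_gt0 (c / 4).
apply: le_trans (ler_wpM2l _ h) _; first by rewrite divr_ge0// ltW.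
rewrite le_eqVlt; apply/orP; left; apply/eqP; field; rewrite gt_eqF//.
Qed.

Lemma theta_ratio_continuous c : 0 < c -> continuous (theta_ratio c).
Proof.
move=> c0 x; apply: cvgM; first exact: theta_continuous.
apply: cvgV; first by rewrite gt_eqF// theta_gt0.
have h : y - 2^-1 @[y --> x] --> x - 2^-1 by apply: cvgB; [exact: cvg_id|exact: cvg_cst].
exact: (cvg_comp _ _ h (theta_continuous c0 (x:=_))).
Qed.

(** The range of [x] is contained in that of [theta_ratio (2 * c)] between -1/2
    and 0, where its values are inverse to each other. *)
Theorem zolotarev c k : 0 < c -> (0 < k)%N ->
  exists a : 'I_k -> R, (forall j, 0 < a j) /\
    forall x, 2 * expR (- (c / 2)) <= x -> x <= expR (c / 2) / 2 ->
      \prod_(j < k) `|x - a j| <= 2 * expR (- (pi ^+ 2 * k%:R / (2 * c))) * \prod_(j < k) (x + a j).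
Proof.
move=> c0 k0; have k0' : 0 < k%:R :> R by rewrite ltr0n.
have c20 : 0 < 2 * c by rewrite mulr_gt0.
(* the points v j and - v j are 2 k consecutive points at distance 1 / (2 k) *)
pose v (j : nat) : R := (2 * j).+1%:R / (4 * k%:R).
exists (fun j => (theta_ratio (2 * c) (v j))^-1).
have d0 u : 0 < theta_ratio (2 * c) u := theta_ratio_gt0 u c20.
have dN0 u : theta_ratio (2 * c) u != 0 by rewrite gt_eqF.
split=> [j|x x1 x2]; first by rewrite invr_gt0.
have [u _ uE] : exists2 u, u \in `[(- 2^-1)%R, 0%R] & theta_ratio (2 * c) u = x.
  have D0 := theta_ratio0_ge c20.
  have D1 : theta_ratio (2 * c) (- 2^-1) = (theta_ratio (2 * c) 0)^-1 by rewrite -theta_ratio_shift// sub0r.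
  apply: IVT; first by rewrite oppr_le0 invr_ge0.
    exact: continuous_subspaceT (theta_ratio_continuous c20).
  have e0 := expR_gt0 (c / 2).
  rewrite (_ : 2 * c / 4 = c / 2) in D0; last by field.
  rewrite ge_min le_max D1; apply/andP; split; apply/orP; [left|right]; last by apply: le_trans D0.
  apply: le_trans x1; rewrite -[leLHS]div1r ler_pdivrMr// expRN.
  have e1 : 0 <= 2 / expR (c / 2) by rewrite divr_ge0// ltW.
  apply: le_trans (ler_wpM2l e1 D0).
  by rewrite [leRHS](_ : _ = 1)//; field; rewrite gt_eqF.
have fac j : `|x - (theta_ratio (2 * c) (v j))^-1| =
    `|alt_ratio c (u + v j) * alt_ratio c (u - v j)| * (x + (theta_ratio (2 * c) (v j))^-1).
  rewrite alt_ratioM// uE -[X in _ = _ * X]gtr0_norm; last by rewrite -uE addr_gt0 ?invr_gt0.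
  rewrite -normrM; congr `|_|; have := d0 (v j); have := d0 u; rewrite uE.
  move: (theta_ratio _ _) => d xx dd; field; rewrite !gt_eqF//; nra.
under [leLHS]eq_bigr do rewrite fac.
rewrite big_split /= ler_wpM2r//.
  by apply: prodr_ge0 => j _; rewrite -uE addr_ge0 ?invr_ge0// ltW.
have fold : \prod_(j < k) (alt_ratio c (u + v j) * alt_ratio c (u - v j)) =
   \prod_(i < 2 * k) alt_ratio c (u + ((2 * i).+1%:R - (2 * k)%:R) / (2 * (2 * k)%:R)).
  transitivity (\prod_(t < 2 * k) alt_ratio c (u + (2 * (t%:Z - k%:Z)%:~R + 1) / (4 * k%:R))).
    rewrite -(prod_int_fold (fun t : int => alt_ratio c (u + (2 * t%:~R + 1) / (4 * k%:R)))).
    apply: eq_bigr => j _; congr (alt_ratio c _ * alt_ratio c _); rewrite /v -natr1 natrM.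
      by rewrite -pmulrn.
    by rewrite rmorphB rmorphN /= -pmulrn; field; rewrite gt_eqF.
  apply: eq_bigr => t _; congr (alt_ratio c (u + _)); rewrite rmorphB /= -natr1 !natrM -!pmulrn.
  by field; rewrite gt_eqF.
rewrite -normr_prod fold.
have n0 : (0 < 2 * k)%N by lia.
have cn0 : 0 < c / (2 * k)%:R by rewrite divr_gt0// ltr0n.
have -> : pi ^+ 2 * k%:R / (2 * c) = pi ^+ 2 / (4 * (c / (2 * k)%:R)).
  by rewrite natrM; move: (pi ^+ 2) => p; field; rewrite !gt_eqF.
apply: le_trans (rho_le_expR cn0).
have h := alt_ratio_lim (z := 0) cn0.
rewrite (_ : (fun M => _) = (fun M => tanhprod M (c / (2 * k)%:R))) in h; last first.
  by apply/funext => M; apply: eq_bigr => m _; rewrite subr0 addr0 expr2.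
rewrite /rho -(cvg_lim _ h)//; apply: limr_ge; first by apply/cvg_ex; eexists; exact: h.
by apply: nearW => J; apply: alt_ratio_collapse.
Qed.

End Zolotarev.

Local Open Scope complex_scope.
Local Open Scope sesquilinear_scope.

(** * Singular values *)

Section SingularValues.
Variable R : realType.
Local Notation C := R[i].

Definition sqnorm n (v : 'cV[C]_n) : C := \sum_(i < n) `|v i 0| ^+ 2.

Lemma sqnormE n (v : 'cV[C]_n) : sqnorm v = (v ^t* *m v) 0 0.
Proof. by rewrite mxE; apply: eq_bigr => i _; rewrite !mxE normCKC. Qed.

Lemma sqnorm_ge0 n (v : 'cV[C]_n) : 0 <= sqnorm v.
Proof. by apply: sumr_ge0 => i _; rewrite exprn_ge0. Qed.

Lemma sqnorm_eq0 n (v : 'cV[C]_n) : sqnorm v = 0 -> v = 0.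
Proof.
move=> /eqP; rewrite psumr_eq0 => [/allP h|i _]; last by rewrite exprn_ge0.
apply/matrixP => i j; rewrite ord1 mxE; have := h i (mem_index_enum _).
by rewrite /= expf_eq0 /= normr_eq0 => /eqP.
Qed.

Lemma unitarymxC n (P : 'M[C]_n) : P \is unitarymx -> P ^t* *m P = 1%:M.
Proof. by move=> /unitarymxP/mulmx1C. Qed.

Lemma sqnorm_unitary n (P : 'M[C]_n) (v : 'cV[C]_n) : P \is unitarymx ->
  sqnorm (P *m v) = sqnorm v.
Proof.
move=> Pu; rewrite !sqnormE trmx_mul map_mxM /= -mulmxA (mulmxA (P ^t*)).
by rewrite unitarymxC// mul1mx.
Qed.

Lemma sqnorm_diag n (d : 'rV[C]_n) (u : 'cV[C]_n) :
  (u ^t* *m (diag_mx d *m u)) 0 0 = \sum_(j < n) d 0 j * `|u j 0| ^+ 2.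
Proof.
by rewrite mxE; apply: eq_bigr => j _; rewrite mul_diag_mx !mxE mulrCA normCKC.
Qed.

Lemma exists_wide_ker s k (F : 'M[C]_(k, s)) : (k < s)%N ->
  exists2 y : 'cV[C]_s, y != 0 & F *m y = 0.
Proof.
move=> ks; have : kermx (F^T) != 0.
  by rewrite -mxrank_eq0 mxrank_ker subn_eq0 -ltnNge (leq_ltn_trans (rank_leq_col _)).
move=> /rowV0Pn[y /sub_kermxP yF y0]; exists (y^T).
  by apply: contraNneq y0 => /(congr1 trmx); rewrite trmxK trmx0 => ->.
by apply: trmx_inj; rewrite trmx_mul trmxK yF trmx0.
Qed.

Section Gram.
Variables (m n : nat) (X : 'M[C]_(m, n)).
Let G := X ^t* *m X.
Let P := spectralmx G.
Let d := spectral_diag G.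

Let Pu : P \is unitarymx := spectral_unitarymx G.

Lemma gram_spectral : G = P ^t* *m diag_mx d *m P.
Proof.
have Gn : G \is normalmx.
  by apply/normalmxP; rewrite /G trmx_mul map_mxM /= trmxCK.
by have /orthomx_spectralP {1}-> := Gn; rewrite invmx_unitary.
Qed.

Lemma sqnorm_gram (v : 'cV[C]_n) :
  sqnorm (X *m v) = \sum_(j < n) d 0 j * `|(P *m v) j 0| ^+ 2.
Proof.
rewrite sqnormE trmx_mul map_mxM /= -mulmxA (mulmxA (X ^t*)) -/G gram_spectral.
by rewrite -sqnorm_diag trmx_mul map_mxM /= !mulmxA.
Qed.

Lemma spectral_diag_gram_ge0 j : 0 <= d 0 j.
Proof.
have := sqnorm_ge0 (X *m (P ^t* *m delta_mx j (0 : 'I_1))).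
rewrite sqnorm_gram mulmxA (unitarymxP Pu) mul1mx (bigD1 j)//= big1 ?addr0.
  by rewrite mxE !eqxx normr1 expr1n mulr1.
by move=> i ij; rewrite mxE (negPf ij) normr0 expr0n mulr0.
Qed.

Let s j : R := Num.sqrt (complex.Re (d 0 j)).

Lemma spectral_diag_gramE j : d 0 j = (s j ^+ 2)%:C.
Proof.
have d0 := spectral_diag_gram_ge0 j.
rewrite /s sqr_sqrtr; last by move: d0; rewrite lecE => /andP[_].
by rewrite RRe_real// ger0_real.
Qed.

Lemma mem_singular_values x : (x \in singular_values X) = [exists j, x == s j].
Proof.
rewrite mem_sort; apply/mapP/existsP => [[j _ ->]|[j /eqP ->]]; first by exists j.
by exists j; rewrite ?mem_enum.
Qed.

Lemma sorted_singular_values : sorted >=%R (singular_values X).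
Proof. by apply: sort_sorted => x y; exact: le_total. Qed.

(** The largest eigenvalue of [X^* X] is the square of [norm2 X]. *)
Lemma sqnorm_mulmx_le (v : 'cV[C]_n) :
  sqnorm (X *m v) <= (norm2 X ^+ 2)%:C * sqnorm v.
Proof.
rewrite sqnorm_gram -(sqnorm_unitary v Pu) mulr_sumr; apply: ler_sum => j _.
apply: ler_wpM2r; first by rewrite exprn_ge0.
rewrite spectral_diag_gramE lecR.
apply: lerXn2r; rewrite ?nnegrE ?sqrtr_ge0 ?sigma_ge0//.
have : s j \in singular_values X by rewrite mem_singular_values; apply/existsP; exists j.
rewrite /norm2 /sigma /=; have := sorted_singular_values.
case: (singular_values X) => //= x l; rewrite (path_sortedE) => [/andP[/allP h _]|].
  by rewrite inE => /orP[/eqP ->|/h].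
by move=> a b c /= ab bc; apply: le_trans bc ab.
Qed.

(** Half of the min-max principle. If more than [r] singular values exceeded [t],
    the corresponding right singular vectors would span a space that meets the range
    of [B], of codimension at most [r], in a nonzero vector. *)
Lemma sigma_le_of_subspace (t : R) (q r : nat) (B : 'M[C]_(n, q)) :
  0 <= t -> (n <= r + q)%N -> (forall y : 'cV_q, B *m y = 0 -> y = 0) ->
  (forall y : 'cV_q, sqnorm (X *m (B *m y)) <= (t ^+ 2)%:C * sqnorm (B *m y)) ->
  sigma X r.+1 <= t.
Proof.
move=> t0 nrs Binj BX; rewrite leNgt; apply/negP => tr.
pose J : {pred 'I_n} := [pred j | t < s j].
have cJ : (r < #|J|)%N.
  have -> : #|J| = count (fun x => t < x) (singular_values X).
    rewrite /singular_values count_sort count_map -sum1_card -sum1_count big_enum_cond /=.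
    by apply: eq_bigl => j; rewrite inE.
  have : (r < size (singular_values X))%N.
    by rewrite ltnNge; apply/negP => hs; move: tr; rewrite /sigma nth_default// ltNge t0.
  move: tr; rewrite /sigma /=; have := sorted_singular_values.
  elim: (singular_values X) (r) => [|x l IH] [|k] //= hp tx.
    by move=> _; rewrite tx.
  rewrite ltnS => kl; rewrite -addn1 addnC leq_add//; last exact: IH (path_sorted hp) tx kl.
  rewrite lt0b; apply: lt_le_trans tx _.
  move: hp; rewrite path_sortedE => [/andP[/allP hl _]|a b c /= ab bc]; last exact: le_trans bc ab.
  by apply: hl; rewrite mem_nth.
pose F : 'M[C]_(#|[predC J]|, q) := \matrix_(i, j) (P *m B) (enum_val i) j.
have cJ' : (#|[predC J]| < q)%N by rewrite -(ltn_add2l #|J|) cardC card_ord; apply: leq_ltn_trans nrs _; rewrite ltn_add2r.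
have [y y0 Fy] := exists_wide_ker F cJ'.
set v := B *m y.
have uJ j : j \notin J -> (P *m v) j 0 = 0.
  move=> jJ; have jJ' : j \in [predC J] by rewrite inE.
  have := congr1 (fun M : 'cV_ _ => M (enum_rank_in jJ' j) 0) Fy.
  rewrite [in RHS]mxE => <-; rewrite /v mulmxA !mxE; apply: eq_bigr => i _.
  by rewrite [F _ _]mxE enum_rankK_in.
have v0 : 0 < sqnorm v.
  rewrite lt_def sqnorm_ge0 andbT; apply: contraNneq y0 => /sqnorm_eq0.
  by move=> /Binj ->.
suff h : (t ^+ 2)%:C * sqnorm v < sqnorm (X *m v) by have := lt_le_trans h (BX y); rewrite ltxx.
rewrite sqnorm_gram -(sqnorm_unitary v Pu) /sqnorm mulr_sumr.
rewrite (bigID (mem J)) /= [X in _ + X]big1 ?addr0; last first.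
  by move=> j jJ; rewrite uJ// normr0 expr0n mulr0.
rewrite [ltRHS](bigID (mem J)) /= [X in _ < _ + X]big1 ?addr0; last first.
  by move=> j jJ; rewrite uJ// normr0 expr0n mulr0.
have v0' : 0 < \sum_(j in J) `|(P *m v) j 0| ^+ 2.
  move: v0; rewrite -(sqnorm_unitary v Pu) /sqnorm (bigID (mem J)) /= [X in _ + X]big1 ?addr0//.
  by move=> j jJ; rewrite uJ// normr0 expr0n.
have [j jJ uj] : exists2 j, j \in J & (P *m v) j 0 != 0.
  apply: contrapT => h; move: v0'; rewrite big1 ?ltxx// => j jJ.
  have [->|uj] := eqVneq ((P *m v) j 0) 0; first by rewrite normr0 expr0n.
  by case: h; exists j.
have lt2 i : i \in J -> (t ^+ 2)%:C < d 0 i.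
  rewrite inE => ti; rewrite spectral_diag_gramE ltcR.
  by apply: ltrXn2r => //; rewrite nnegrE// ltW// (le_lt_trans t0).
rewrite (bigD1 j)//= [ltRHS](bigD1 j)//=; apply: ltr_leD.
  by rewrite ltr_pM2r ?lt2// exprn_gt0// normr_gt0.
by apply: ler_sum => i /andP[iJ _]; apply: ler_wpM2r; [rewrite exprn_ge0|exact/ltW/lt2].
Qed.

End Gram.
End SingularValues.

(** * Krylov matrices and polynomials at roots of -1 *)

Section Krylov.
Variable R : realType.
Local Notation C := R[i].

(** A polynomial of size at most [n] as a vector. *)
Definition coefcol n (p : {poly C}) : 'cV[C]_n := \col_j p`_j.

(** The vector on the left is [p(A) w]; the [x i] are the eigenvalues of [A] and the
    [c i] the coordinates of [w] in an orthonormal basis of eigenvectors. *)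
Lemma krylov_coefcol m n (A : 'M[C]_m) (w : 'cV[C]_m) : A \is hermsymmx ->
  exists (x : 'I_m -> R) (c : 'I_m -> C), forall p : {poly C}, (size p <= n)%N ->
    sqnorm (krylov n A w *m coefcol n p) =
    \sum_(i < m) `|p.[(x i)%:C]| ^+ 2 * `|c i| ^+ 2.
Proof.
move=> Ah; pose P := spectralmx A; pose d := spectral_diag A.
have Pu : P \is unitarymx := spectral_unitarymx A.
have AE : A = P ^t* *m diag_mx d *m P.
  have /orthomx_spectralP {1}-> := hermitian_normalmx Ah; by rewrite invmx_unitary.
have dr j : d 0 j \is Num.real.
  exact: (mxOverP (hermitian_spectral_diag_real Ah) 0 j).
pose x j : R := complex.Re (d 0 j).
have dE j : d 0 j = (x j)%:C by rewrite RRe_real.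
exists x, (fun i => (P *m w) i 0) => p sp.
rewrite -(sqnorm_unitary _ Pu); apply: eq_bigr => i _.
rewrite -exprMn -normrM; congr (`|_| ^+ 2).
have PA j : P *m (A ^+ j *m w) = \col_i ((d 0 i) ^+ j * (P *m w) i 0).
  elim: j => [|j IH].
    by rewrite expr0 mul1mx; apply/matrixP => a b; rewrite ord1 [RHS]mxE expr0 mul1r.
  have -> : A ^+ j.+1 *m w = A *m (A ^+ j *m w) by rewrite exprS -mulmxA.
  rewrite {1}AE !mulmxA (unitarymxP Pu) mul1mx -!mulmxA IH.
  by apply/matrixP => a b; rewrite mul_diag_mx !mxE exprS mulrA.
have -> : krylov n A w *m coefcol n p = \sum_(j < n) p`_j *: (A ^+ j *m w).
  apply/matrixP => a b; rewrite mxE summxE; apply: eq_bigr => j _.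
  by rewrite ord1 /krylov !mxE mulrC.
rewrite mulmx_sumr summxE (horner_coef_wide _ sp) mulr_suml.
by apply: eq_bigr => j _; rewrite -scalemxAr PA !mxE dE mulrA.
Qed.

Definition cis (t : R) : C := (cos t +i* sin t).

Lemma cisD s t : cis (s + t) = cis s * cis t.
Proof. by apply/eqP; rewrite eq_complex /= cosD sinD; apply/andP; split; apply/eqP; ring. Qed.

Lemma cis0 : cis 0 = 1.
Proof. by rewrite /cis cos0 sin0. Qed.

Lemma cis_conj t : (cis t)^*%C = cis (- t).
Proof. by rewrite /cis cosN sinN. Qed.

Lemma cisX t k : cis t ^+ k = cis (k%:R * t).
Proof.
elim: k => [|k IH]; first by rewrite expr0 mul0r cis0.
by rewrite exprS IH -cisD -natr1 mulrDl mul1r addrC.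
Qed.

(** For [l < N], the [cis (2 * half_angle N l)] are the roots of [X^N = -1]; half
    angles are what the Cayley transform needs. *)
Definition half_angle N (l : nat) : R := (2 * l).+1%:R * (pi / (2 * N%:R)).

Lemma cis_orth N a b : (a < N)%N -> (b < N)%N ->
  \sum_(l < N) cis (2 * half_angle N l) ^+ a * (cis (2 * half_angle N l) ^+ b)^*%C =
  (N * (a == b))%:R.
Proof.
move=> aN bN.
have N0 : 0 < N%:R :> R by rewrite ltr0n; lia.
have pi0 := pi_gt0 R.
pose z : R := (a%:R - b%:R) * (pi / N%:R).
have E (l : 'I_N) : cis (2 * half_angle N l) ^+ a * (cis (2 * half_angle N l) ^+ b)^*%C =
    cis z * cis (2 * z) ^+ l.
  rewrite !cisX cis_conj -!cisD; congr cis; rewrite /z /half_angle -[(2 * l).+1%:R](natr1 (2 * l)) natrM.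
  by move: (pi : R) => p; field; rewrite gt_eqF.
rewrite (eq_bigr _ (fun l _ => E l)) -mulr_sumr.
have [ab|ab] := eqVneq a b.
  rewrite /z ab subrr mul0r mulr0 cis0 mul1r muln1.
  by rewrite (eq_bigr (fun=> 1)) => [|l _]; rewrite ?expr1n// sumr_const card_ord.
rewrite muln0 (_ : \sum_(l < N) _ = 0) ?mulr0//.
have z1 : 1 - cis (2 * z) != 0.
  have sz : sin z != 0.
    wlog ba : a b aN bN ab @z {E} / (b < a)%N => [hw|].
      case: (ltngtP b a) => [ba|ab'|/esym/eqP]; [exact: hw| |by rewrite (negPf ab)].
      have := hw b a bN aN; rewrite eq_sym => /(_ ab ab').
      rewrite (_ : (b%:R - a%:R) * (pi / N%:R) = - z) ?sinN ?oppr_eq0//.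
      by rewrite /z -opprB mulNr.
    rewrite gt_eqF// sin_gt0_pi//; apply/andP; split.
      by rewrite mulr_gt0 ?divr_gt0// subr_gt0 ltr_nat.
    rewrite /z mulrA ltr_pdivrMr// mulrC ltr_pM2l//.
    have : a%:R < N%:R :> R by rewrite ltr_nat.
    have : 0 <= b%:R :> R by []; lra.
  apply: contraNneq sz => /eqP; rewrite subr_eq0 eq_complex /= => /andP[/eqP h _].
  move: h; rewrite mulr_natl cos_mulr2n cos2sin2 => h.
  by rewrite -[_ == _]/(_ == _) -sqrf_eq0; apply/eqP; lra.
have geo k : (1 - cis (2 * z)) * (\sum_(l < k) cis (2 * z) ^+ l) = 1 - cis (2 * z) ^+ k.
  elim: k => [|k IH]; first by rewrite big_ord0 mulr0 expr0 subrr.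
  rewrite big_ord_recr mulrDr IH exprS /=; ring.
apply: (mulfI z1); rewrite geo mulr0; apply/eqP; rewrite subr_eq0 eq_sym; apply/eqP.
rewrite cisX /z (_ : N%:R * _ = (a%:R - b%:R) * (pi *+ 2)); last first.
  by rewrite -mulr_natl; move: (pi : R) => p; field; rewrite gt_eqF.
have per k : cis (k%:R * (pi *+ 2)) = 1 by rewrite -cisX /cis cos2pi sin2pi expr1n.
rewrite mulrBl cisD per mul1r -cis_conj per.
by apply/eqP; rewrite conjc1.
Qed.

Lemma parseval N (p : {poly C}) : (size p <= N)%N ->
  \sum_(l < N) `|p.[cis (2 * half_angle N l)]| ^+ 2 = N%:R * \sum_(j < N) `|p`_j| ^+ 2.
Proof.
move=> sp.
under eq_bigr do rewrite sqr_normc (horner_coef_wide _ sp) rmorph_sum /= big_distrlr /=.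
rewrite exchange_big mulr_sumr /=; apply: eq_bigr => a _.
rewrite exchange_big /= (bigD1 a)//= [X in _ + X]big1 ?addr0.
  under eq_bigr do rewrite rmorphM /= mulrACA.
  by rewrite -mulr_sumr cis_orth// eqxx muln1 sqr_normc mulrC.
move=> b ba; under eq_bigr do rewrite rmorphM /= mulrACA.
by rewrite -mulr_sumr cis_orth// eq_sym (negPf ba : (b : nat) == a = false) muln0 mulr0.
Qed.

Lemma sqnorm_coefcol n N (p : {poly C}) : (size p <= N)%N -> (N <= n)%N ->
  sqnorm (coefcol n p) = \sum_(j < N) `|p`_j| ^+ 2.
Proof.
move=> sp Nn; rewrite /sqnorm.
under eq_bigr do rewrite mxE.
rewrite -(big_mkord xpredT (fun j => `|p`_j| ^+ 2)) (big_cat_nat (n := N))//=.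
rewrite [X in _ + X]big_nat_cond [X in _ + X]big1 ?addr0 ?big_mkord// => j /andP[/andP[Nj _] _].
by rewrite nth_default ?normr0 ?expr0n// (leq_trans sp).
Qed.

End Krylov.

(** * Blaschke products *)

Section Cayley.
Variable R : realType.
Local Notation C := R[i].
Implicit Types a x u : R.

(** The unit complex number whose half angle has tangent [a]. *)
Definition cayley a : C := (1 +i* a) / (1 +i* (- a)).

Lemma one_im_neq0 a : (1 +i* a : C) != 0.
Proof. by rewrite eq_complex /= oner_eq0. Qed.

Lemma cayley_neq0 a : cayley a != 0.
Proof. by rewrite mulf_neq0 ?invr_eq0 ?one_im_neq0. Qed.

Lemma cayley_conj a : (cayley a)^*%C = cayley (- a).
Proof. by rewrite /cayley rmorphM fmorphV /= opprK. Qed.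

Lemma cayleyN a : cayley (- a) = (cayley a)^-1.
Proof. by rewrite /cayley opprK invf_div. Qed.

Lemma normr_cayley a : `|cayley a| = 1.
Proof.
apply/eqP; rewrite -(@pexpr_eq1 _ _ 2)// sqr_normc cayley_conj cayleyN divff//.
exact: cayley_neq0.
Qed.

Lemma cis_neq0 u : cis u != 0.
Proof.
have : cis u * cis (- u) = 1 by rewrite -cisD subrr cis0.
by apply: contra_eq_neq => ->; rewrite mul0r eq_sym oner_eq0.
Qed.

(** Differences of points of the unit circle, in the Cayley coordinate and without
    dividing by [cos u]. *)
Lemma cis_sub_cayley u a :
  cis (2 * u) - cayley a =
  2 * 'i / (cis (- u) * (1 +i* (- a))) * (sin u - a * cos u)%:C.
Proof.
have c0 := cis_neq0 (- u).
have q0 := one_im_neq0 (- a).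
have e1 : cis (2 * u) * cis (- u) = cis u by rewrite -cisD; congr cis; ring.
have D0 : cis (- u) * (1 +i* (- a)) != 0 by rewrite mulf_neq0.
apply: (mulIf D0); rewrite mulrBl mulrA e1 /cayley.
rewrite [X in _ - X](_ : _ = (1 +i* a) * cis (- u)); last by field.
rewrite [RHS](_ : _ = 2 * 'i * (sin u - a * cos u)%:C); last by field; rewrite c0 q0.
rewrite /cis sinN cosN; apply/eqP; rewrite eq_complex /=.
by apply/andP; split; apply/eqP; ring.
Qed.

Lemma normr_real_sub_cayley x a : `|x%:C - cayley a| = `|x%:C - cayley (- a)|.
Proof. by rewrite -normcJ rmorphB [X in _ - X]cayley_conj [X in X - _]conjc_real. Qed.

Variables (k : nat) (a : 'I_k -> R).
Hypothesis a0 : forall j, 0 < a j.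

Lemma normC_real x : `|x%:C| = `|x|%:C :> C.
Proof. by rewrite normc_def /= expr0n addr0 sqrtr_sqr. Qed.

Definition blaschke_num : {poly C} := \prod_(j < k) ('X - (cayley (a j))%:P).
Definition blaschke_den : {poly C} := \prod_(j < k) ('X - (cayley (- a j))%:P).
Definition blaschke_phase : C := \prod_(j < k) cayley (a j).

(** The phase makes the two terms have the same argument on the unit circle, so
    that they cannot cancel. *)
Definition bsum : {poly C} :=
  blaschke_num ^+ 2 + (blaschke_phase ^+ 2)%:P * blaschke_den ^+ 2.
Definition bprod : {poly C} := blaschke_num * blaschke_den.

Lemma normr_phase : `|blaschke_phase| = 1.
Proof. by rewrite normr_prod big1// => j _; rewrite normr_cayley. Qed.

Lemma phase_neq0 : blaschke_phase != 0.
Proof. by rewrite -normr_eq0 normr_phase oner_eq0. Qed.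

Lemma size_num : size blaschke_num = k.+1.
Proof. by rewrite size_prod_XsubC /index_enum -enumT size_enum_ord. Qed.

Lemma size_den : size blaschke_den = k.+1.
Proof. by rewrite size_prod_XsubC /index_enum -enumT size_enum_ord. Qed.

Lemma size_bsum : (size bsum <= (2 * k).+1)%N.
Proof.
apply: leq_trans (size_polyD _ _) _; rewrite geq_max; apply/andP; split.
  by apply: leq_trans (size_poly_exp_leq _ _) _; rewrite size_num /= mulnC.
rewrite mul_polyC; apply: leq_trans (size_scale_leq _ _) _.
by apply: leq_trans (size_poly_exp_leq _ _) _; rewrite size_den /= mulnC.
Qed.

Lemma size_bprod : (size bprod <= (2 * k).+1)%N.
Proof. by apply: leq_trans (size_polyMleq _ _) _; rewrite size_num size_den; lia. Qed.

Lemma horner_bsum z : bsum.[z] =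
  blaschke_num.[z] ^+ 2 + blaschke_phase ^+ 2 * blaschke_den.[z] ^+ 2.
Proof. by rewrite /bsum hornerD mul_polyC hornerZ !horner_exp. Qed.

Lemma horner_bprod z : bprod.[z] = blaschke_num.[z] * blaschke_den.[z].
Proof. exact: hornerM. Qed.

Lemma bsum_le_bprod_real x : `|bsum.[x%:C]| <= 2 * `|bprod.[x%:C]|.
Proof.
have e : `|blaschke_num.[x%:C]| = `|blaschke_den.[x%:C]|.
  rewrite /blaschke_num /blaschke_den !horner_prod !normr_prod; apply: eq_bigr => j _.
  by rewrite !hornerXsubC normr_real_sub_cayley.
rewrite horner_bsum horner_bprod.
apply: le_trans (ler_normD _ _) _.
rewrite normrX normrM !normrX normr_phase expr1n mul1r [in leRHS]normrM e -expr2.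
by rewrite mulr_natl mulr2n.
Qed.

(** At [cis (2 * u)], [bsum] and [bprod] are [p ^+ 2 + q ^+ 2] and [p * q] up to
    factors of the same modulus. *)
Lemma bprod_le_bsum_circle (u : R) (B : R) : 0 <= B ->
  let p := \prod_(j < k) (sin u - a j * cos u) in
  let q := \prod_(j < k) (sin u + a j * cos u) in
  `|p| <= B * `|q| \/ `|q| <= B * `|p| ->
  `|bprod.[cis (2 * u)]| <= B%:C * `|bsum.[cis (2 * u)]|.
Proof.
move=> B0 p q pq; pose z := cis (2 * u).
pose f : C := \prod_(j < k) (2 * 'i / (cis (- u) * (1 +i* (- a j)))).
have e1 : blaschke_num.[z] = f * p%:C.
  rewrite horner_prod rmorph_prod -big_split /=; apply: eq_bigr => j _.
  by rewrite hornerXsubC cis_sub_cayley.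
have e2 : blaschke_den.[z] = f / blaschke_phase * q%:C.
  rewrite horner_prod rmorph_prod -prodf_div -big_split /=; apply: eq_bigr => j _.
  rewrite hornerXsubC cis_sub_cayley opprK mulNr opprK; congr (_ * _).
  rewrite /cayley; have := one_im_neq0 (a j); have := one_im_neq0 (- a j); have := cis_neq0 (- u).
  move: (cis _) (_ +i* a j) (_ +i* (- a j)) => X Y Z X0 Y0 Z0.
  by field; rewrite X0 Y0 Z0.
have x0 := phase_neq0.
have Nm : bsum.[z] = f ^+ 2 * (p ^+ 2 + q ^+ 2)%:C.
  rewrite horner_bsum e1 e2 rmorphD !rmorphXn /=.
  by field.
have Dm : bprod.[z] = f ^+ 2 / blaschke_phase * (p * q)%:C.
  by rewrite horner_bprod e1 e2 rmorphM /=; field.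
rewrite Nm Dm !normrM normfV normr_phase invr1 mulr1 mulrCA.
apply: ler_wpM2l; first by rewrite mulr_ge0.
rewrite !normC_real -rmorphM lecR (ger0_norm (addr_ge0 (sqr_ge0 p) (sqr_ge0 q))) normrM.
rewrite -(real_normK (num_real p)) -(real_normK (num_real q)).
have := normr_ge0 p; have := normr_ge0 q; case: pq; move: `|p| `|q| => s t; nra.
Qed.

(** At a root of [blaschke_num] only the second term is left, and the roots of
    [blaschke_den] are in the other half plane. *)
Lemma bsum_neq0 : (0 < k)%N -> bsum != 0.
Proof.
move=> k0; pose j0 := Ordinal k0; apply/eqP => b0.
have : bsum.[cayley (a j0)] != 0; last by rewrite b0 horner0 eqxx.
rewrite horner_bsum (_ : blaschke_num.[_] = 0) ?expr0n ?add0r; last first.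
  by rewrite horner_prod (bigD1 j0)//= hornerXsubC subrr mul0r.
rewrite mulf_neq0 ?expf_neq0 ?phase_neq0// horner_prod prodf_seq_neq0; apply/allP => j _ /=.
rewrite hornerXsubC subr_eq0 /cayley opprK eqr_div ?one_im_neq0//.
rewrite eq_complex /=; apply/negP => /andP[_ /eqP h].
by have := a0 j0; have := a0 j; lra.
Qed.

End Cayley.

Section Nodes.
Variable R : realType.

(** As [N] is even, [half_angle N l] is at distance at least [pi / (2 N)] from
    0, [pi / 2] and [pi]. *)
Lemma half_angle_bounds N l (t := pi / (2 * N%:R) : R) : (l < N)%N -> ~~ odd N ->
  [/\ 0 < sin (half_angle R N l), t * `|cos (half_angle R N l)| <= sin (half_angle R N l) &
      t * sin (half_angle R N l) <= `|cos (half_angle R N l)|].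
Proof.
move=> lN Ne; have pi0 := pi_gt0 R.
have N0 : 0 < N%:R :> R by rewrite ltr0n; lia.
have t0 : 0 < t by rewrite /t divr_gt0 ?mulr_gt0.
have piE : pi = 2 * N%:R * t by rewrite /t; move: (pi : R) => p; field; rewrite gt_eqF.
have uE : half_angle R N l = (2 * l).+1%:R * t by [].
set u := half_angle R N l in uE *.
have l1 : t <= u by rewrite uE; apply: ler_peMl; [exact: ltW|rewrite ler1n].
have l2 : u + t <= pi.
  rewrite uE piE -[X in _ + X <= _]mul1r -mulrDl ler_pM2r// natr1 -natrM ler_nat; lia.
have s0 : 0 < sin u by apply: sin_gt0_pi; apply/andP; split; lra.
split=> //.
  have [c0|c0] := leP 0 (cos u).
    rewrite ger0_norm//; apply: le_trans (mulr_cos_le_sin (x := u) _); last by apply/andP; split; lra.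
    exact: ler_wpM2r.
  rewrite ltr0_norm//; have h := @mulr_cos_le_sin R (pi - u).
  have e1 : sin (pi - u) = sin u by rewrite sinB sinpi cospi; ring.
  have e2 : cos (pi - u) = - cos u by rewrite cosB sinpi cospi; ring.
  rewrite e1 e2 in h; apply: le_trans (h _); last by apply/andP; split; lra.
  by apply: ler_wpM2r; lra.
pose g := `|pi / 2 - u|.
have tg : t <= g.
  have e : pi / 2 - u = (N%:R - (2 * l).+1%:R) * t by rewrite piE uE; field.
  rewrite /g e normrM (gtr0_norm t0); apply: ler_peMl; first exact: ltW.
  have -> : N%:R - (2 * l).+1%:R = (N%:Z - (2 * l).+1%:Z)%:~R :> R by rewrite rmorphB.
  rewrite -intr_norm ler1z; lia.
have gp : g <= pi by rewrite ler_norml; apply/andP; split; lra.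
have := @mulr_cos_le_sin R g; rewrite normr_ge0 gp => /(_ isT).
have -> : cos g = sin u.
  by rewrite /g cos_norm cosB cos_pihalf sin_pihalf; ring.
have <- : `|cos u| = sin g.
  have sg0 : 0 <= sin g by apply: sin_ge0_pi; apply/andP; split=> //; exact: normr_ge0.
  rewrite -[RHS]ger0_norm//; have e : cos u = sin (pi / 2 - u).
    by rewrite sinB cos_pihalf sin_pihalf; ring.
  rewrite e /g; have [h|h] := leP 0 (pi / 2 - u); first by rewrite (ger0_norm h).
  by rewrite (ltr0_norm h) sinN normrN.
by apply: le_trans; apply: ler_wpM2r => //; exact: ltW.
Qed.

End Nodes.

(** * The rank bound *)

Section Final.
Variable R : realType.
Local Notation C := R[i].

(** A root of [X^N = -1] in the lower half plane has a negative Cayley coordinate,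
    which exchanges the two products. *)
Lemma bprod_le_bsum_half_angle N l k (a : 'I_k -> R) (B : R) (t := pi / (2 * N%:R) : R) :
  (l < N)%N -> ~~ odd N -> 0 <= B -> (forall j, 0 < a j) ->
  (forall x, t <= x -> x <= t^-1 ->
     \prod_(j < k) `|x - a j| <= B * \prod_(j < k) (x + a j)) ->
  `|(bprod a).[cis (2 * half_angle R N l)]| <= B%:C * `|(bsum a).[cis (2 * half_angle R N l)]|.
Proof.
move=> lN Ne B0 a0 Hz; set u := half_angle R N l.
have pi0 := pi_gt0 R; have N0 : 0 < N%:R :> R by rewrite ltr0n; lia.
have t0 : 0 < t by rewrite /t divr_gt0 ?mulr_gt0.
have [s0 h1 h2] := half_angle_bounds R lN Ne.
rewrite -/u -/t in s0 h1 h2.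
have c0 : 0 < `|cos u| by apply: lt_le_trans h2; rewrite mulr_gt0.
set co := `|cos u| in h1 h2 c0.
have key : `|\prod_(j < k) (sin u - a j * co)| <= B * `|\prod_(j < k) (sin u + a j * co)|.
  have := Hz (sin u / co); rewrite ler_pdivlMr// ler_pdivrMr// => /(_ h1).
  rewrite mulrC ler_pdivlMr// mulrC => /(_ h2) h.
  have e1 : `|\prod_(j < k) (sin u - a j * co)| = co ^+ k * \prod_(j < k) `|sin u / co - a j|.
    rewrite normr_prod -[k in co ^+ k]card_ord -prodr_const -big_split /=; apply: eq_bigr => j _.
    have -> : co * `|sin u / co - a j| = `|co * (sin u / co - a j)| by rewrite normrM (gtr0_norm c0).
    by congr `|_|; field; exact: lt0r_neq0.
  have e2 : `|\prod_(j < k) (sin u + a j * co)| = co ^+ k * \prod_(j < k) (sin u / co + a j).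
    rewrite normr_prod -[k in co ^+ k]card_ord -prodr_const -big_split /=; apply: eq_bigr => j _.
    by rewrite gtr0_norm ?addr_gt0 ?mulr_gt0//; field; exact: lt0r_neq0.
  rewrite e1 e2 mulrCA; apply: ler_wpM2l => //; exact/exprn_ge0/ltW.
apply: bprod_le_bsum_circle => //; move: key; rewrite /co.
have [cu|cu] := leP 0 (cos u); first by rewrite (ger0_norm cu) => key; left.
rewrite (ltr0_norm cu) => key; right.
under eq_bigr do rewrite -[a _ * _]opprK -mulrN.
under [in leRHS]eq_bigr do rewrite -[- (a _ * _)]mulrN.
exact: key.
Qed.

(** Compare [p = bsum a * q] with [bprod a * q]: on the eigenvalues of [A] their
    quotient is at most 2, and at the roots of [X^N = -1] the inverse quotient is at
    most [B]. *)
Lemma sigma_krylov_le m n (A : 'M[C]_m) (w : 'cV[C]_m) h k (a : 'I_k -> R) (B : R)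
    (N := h.*2) (t := pi / (2 * N%:R) : R) :
  A \is hermsymmx -> (N <= n)%N -> (0 < k)%N -> (k < h)%N -> 0 <= B -> (forall j, 0 < a j) ->
  (forall x, t <= x -> x <= t^-1 ->
     \prod_(j < k) `|x - a j| <= B * \prod_(j < k) (x + a j)) ->
  sigma (krylov n A w) (n - (N - 2 * k)).+1 <= 2 * B * norm2 (krylov n A w).
Proof.
move=> Ah Nn k0 kh B0 a0 Hz; set K := krylov n A w.
have [x [c KE]] := krylov_coefcol n w Ah.
pose q := (N - 2 * k)%N.
(* q is such that these multiples of bsum a have size at most N *)
pose M : 'M[C]_(n, q) := \matrix_(i, j) (bsum a * 'X^j)`_i.
pose g (y : 'cV[C]_q) : {poly C} := \poly_(j < q) (if insub j is Some j' then y j' 0 else 0).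
have gE y (j : 'I_q) : (g y)`_j = y j 0 by rewrite coef_poly ltn_ord valK.
have ME y : M *m y = coefcol n (bsum a * g y).
  apply/matrixP => i z; rewrite ord1 !mxE.
  have -> : g y = \sum_(j < q) y j 0 *: 'X^j.
    apply/polyP => e; rewrite coef_sum coef_poly; case: ifP => eq.
      rewrite insubT /= (bigD1 (Ordinal eq))//= coefZ coefXn eqxx mulr1 big1 ?addr0// => j jn.
      rewrite coefZ coefXn (_ : (e == j) = false) ?mulr0//.
      by apply/negbTE; apply: contraNneq jn => ej; apply/eqP/val_inj.
    rewrite big1// => j _; rewrite coefZ coefXn (_ : (e == j) = false) ?mulr0//.
    by apply/negbTE/eqP => ej; rewrite ej ltn_ord in eq.
  rewrite mulr_sumr coef_sum; apply: eq_bigr => j _.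
  by rewrite !mxE -scalerAr coefZ mulrC.
have sg y : (size (g y) <= q)%N by exact: size_poly.
have sz (r : {poly C}) y : (size r <= (2 * k).+1)%N -> (size (r * g y)%R <= N)%N.
  move=> sr; apply: leq_trans (size_polyMleq _ _) _.
  have := sg y; rewrite /q /N; lia.
have szS y := sz _ y (size_bsum a); have szP y := sz _ y (size_bprod a).
have B20 : 0 <= 2 * B * norm2 K by rewrite !mulr_ge0// sigma_ge0.
apply: (@sigma_le_of_subspace _ _ _ K _ q _ M) => //.
- by rewrite /q; lia.
- move=> y; rewrite ME => /matrixP y0.
  have : bsum a * g y = 0.
    apply/polyP => i; rewrite coef0; case: (ltnP i n) => hi.
      by have := y0 (Ordinal hi) 0; rewrite !mxE.
    by rewrite nth_default// (leq_trans (szS y)) ?(leq_trans Nn).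
  move=> /eqP; rewrite mulf_eq0 (negPf (bsum_neq0 a0 k0)) /= => /eqP g0.
  by apply/matrixP => i j; rewrite ord1 [RHS]mxE -gE g0 coef0.
move=> y; rewrite ME KE; last exact: leq_trans (szS y) Nn.
have hM p z : `|(p * g y).[z]| ^+ 2 = `|p.[z]| ^+ 2 * `|(g y).[z]| ^+ 2 by rewrite hornerM normrM exprMn.
have step1 : \sum_(i < m) `|(bsum a * g y).[(x i)%:C]| ^+ 2 * `|c i| ^+ 2 <=
    4 * sqnorm (K *m coefcol n (bprod a * g y)).
  rewrite KE; last exact: leq_trans (szP y) Nn.
  rewrite mulr_sumr; apply: ler_sum => i _; rewrite [leRHS]mulrA; apply: ler_wpM2r; first by rewrite exprn_ge0.
  rewrite !hM [leRHS]mulrA; apply: ler_wpM2r; first by rewrite exprn_ge0.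
  have -> : 4 * `|(bprod a).[(x i)%:C]| ^+ 2 = (2 * `|(bprod a).[(x i)%:C]|) ^+ 2 by ring.
  apply: lerXn2r; rewrite ?nnegrE ?mulr_ge0//.
  exact: bsum_le_bprod_real.
apply: le_trans step1 _.
have Ne : ~~ odd N by rewrite /N odd_double.
have N0 : 0 < N%:R :> C by rewrite ltr0n /N; lia.
have step2 : sqnorm (coefcol n (bprod a * g y)) <= (B ^+ 2)%:C * sqnorm (coefcol n (bsum a * g y)).
  rewrite !(@sqnorm_coefcol _ _ N)// -(ler_pM2l N0) mulrCA -!parseval// mulr_sumr.
  apply: ler_sum => l _; rewrite !hM [leRHS]mulrA; apply: ler_wpM2r; first by rewrite exprn_ge0.
  rewrite rmorphXn /= -exprMn; apply: lerXn2r; [by rewrite nnegrE| |].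
    rewrite nnegrE; apply: mulr_ge0; [by rewrite ler0c|exact: normr_ge0].
  exact: (bprod_le_bsum_half_angle (ltn_ord l) Ne B0 a0 Hz).
apply: le_trans (ler_wpM2l _ (sqnorm_mulmx_le K _)) _ => //.
have -> : ((2 * B * norm2 K) ^+ 2)%:C = 4 * ((norm2 K ^+ 2)%:C * (B ^+ 2)%:C) :> C.
  rewrite -rmorphM (_ : (2 * B * norm2 K) ^+ 2 = 4 * (norm2 K ^+ 2 * B ^+ 2)); last by ring.
  by rewrite [LHS]rmorphM; congr (_ * _); exact: (rmorph_nat (real_complex R) 4).
rewrite -[leRHS]mulrA -[X in _ <= _ * X]mulrA; apply: ler_wpM2l => //.
by apply: ler_wpM2l; [rewrite ler0c sqr_ge0|exact: step2].
Qed.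

End Final.

Lemma half_double_bounds n : (n./2.*2 <= n <= n./2.*2.+1)%N.
Proof. by lia. Qed.

Lemma codim_le n h k : (n <= h.*2.+1)%N -> (k < h)%N ->
  (n - (h.*2 - 2 * k) <= (2 * k).+1)%N.
Proof. by lia. Qed.

Lemma lez_of_leq_odd e k : (e <= (2 * k).+1)%N -> e%:Z <= 2 * k%:Z + 2.
Proof. by lia. Qed.

Theorem mainTheorem13 (R : realType) (m n : nat) (hn : (2 <= n)%N) (hmn : (n <= m)%N)
    (A : 'M[R[i]]_m) (hA : A \is hermsymmx) (w : 'cV[R[i]]_m)
    (eps : R) (heps : 0 < eps < 1) :
  (epsrank (krylov n A w) heps)%:Z <=
    2 * Num.ceil (4 * ln (8 * (n./2)%:R / pi) * ln (4 / eps) / pi ^+ 2 : R) + 2.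
Proof.
have /andP[e0 e1] := heps.
set h := n./2; set L := ln (8 * h%:R / pi); set E := ln (4 / eps).
have h0 : (0 < h)%N by rewrite half_gt0.
have h0' : 0 < h%:R :> R by rewrite ltr0n.
have pi0 := pi_gt0 R; have pi4 : pi < 4 :> R by have := pihalf_lt2 R; lra.
have pos : 0 < 8 * h%:R / pi :> R by rewrite divr_gt0// mulr_gt0.
have L0 : 0 < L.
  apply: ln_gt0; rewrite ltr_pdivlMr// mul1r; apply: lt_le_trans pi4 _.
  have : 1 <= h%:R :> R by rewrite ler1n. lra.
have pos4 : 0 < 4 / eps by rewrite divr_gt0.
have E0 : 0 < E by apply: ln_gt0; rewrite ltr_pdivlMr// mul1r; lra.
set T := 4 * L * E / pi ^+ 2.
have T0 : 0 < T by rewrite /T divr_gt0 ?exprn_gt0// !mulr_gt0.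
have [k kE] : exists k : nat, Num.ceil T = k%:Z.
  by exists (absz (Num.ceil T)); rewrite gez0_abs// ceil_ge0; lra.
have Tk : T <= k%:R by have := ceil_ge T; rewrite kE.
have k0 : (0 < k)%N by rewrite -(ltr0n R); apply: lt_le_trans Tk.
have /andP[hN hN'] := half_double_bounds n; rewrite -/h in hN hN'.
rewrite kE; apply: lez_of_leq_odd.
rewrite /epsrank; case: ex_minnP => r _ rmin.
(* for h <= k the bound exceeds the number of columns *)
case: (leqP h k) => hk.
  apply: leq_trans (rmin n _) _; last first.
    by apply: leq_trans hN' _; rewrite ltnS -mul2n leq_mul2l hk orbT.
  rewrite /sigma nth_default ?size_singular_values// mulr_ge0 ?sigma_ge0//; exact: ltW.
have L20 : 0 < 2 * L by rewrite mulr_gt0.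
have [a [a0 Ha]] := zolotarev L20 k0.
apply: leq_trans (rmin (n - (h.*2 - 2 * k))%N _) _; last exact: codim_le.
(* the parameter 2 L turns the range of zolotarev into [pi / (2 N), 2 N / pi] *)
set B := 2 * expR (- (pi ^+ 2 * k%:R / (2 * (2 * L)))) in Ha.
have B0 : 0 <= B by rewrite mulr_ge0// expR_ge0.
apply: le_trans (sigma_krylov_le w hA hN k0 hk B0 a0 _) _.
  move=> x x1 x2; apply: Ha.
    apply: le_trans x1; rewrite (_ : 2 * L / 2 = L); last by field.
    rewrite expRN /L lnK ?posrE//.
    rewrite -mul2n natrM le_eqVlt; apply/orP; left; apply/eqP.
    by move: (pi : R) pi0 => p p0; field; rewrite !gt_eqF.
  apply: le_trans x2 _; rewrite (_ : 2 * L / 2 = L); last by field.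
  rewrite /L lnK ?posrE//.
  rewrite -mul2n natrM le_eqVlt; apply/orP; left; apply/eqP.
  by move: (pi : R) pi0 => p p0; field; rewrite !gt_eqF.
apply: ler_wpM2r; first exact: sigma_ge0.
have -> : eps = 4 * expR (- E) by rewrite expRN lnK ?posrE// invf_div; field.
rewrite /B mulrA (_ : 2 * 2 = 4); last by ring.
rewrite ler_pM2l// ler_expR lerN2 ler_pdivlMr ?mulr_gt0//.
move: Tk; rewrite /T ler_pdivrMr ?exprn_gt0// => Tk.
apply: le_trans _ (_ : k%:R * pi ^+ 2 <= _); last by rewrite mulrC.
by apply: le_trans Tk; rewrite le_eqVlt; apply/orP; left; apply/eqP; ring.
Qed.
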